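(* For all $P_1,P_2,N>0$, $$\mathrm{cl}\Big(\bigcup_{\sigma^2>0}\ \bigcap_{\mathsf K}\mathcal C_{\mathrm{NoisyFB}}(P_1,P_2,N,\mathsf K)\Big)=\mathcal C_{\mathrm{PerfectFB}}(P_1,P_2,N),$$ where the intersection is over all $2\times2$ positive semidefinite $\mathsf K$ whose diagonal entries are at most $\sigma^2$.
   Context: Channel model (noisy feedback). Fix $P_1,P_2,N>0$ and a $2\times 2$ positive semidefinite matrix $\mathsf{K}_W=\begin{pmatrix}\sigma_1^2&\varrho\sigma_1\sigma_2\\ \varrho\sigma_1\sigma_2&\sigma_2^2\end{pmatrix}$ with $\sigma_1,\sigma_2\ge 0$, $\varrho\in[-1,1]$. Messages $M_1,M_2$ are independent and uniform on finite sets $\mathcal{M}_1,\mathcal{M}_2$. $\{Z_t\}$ is IID $\mathcal{N}(0,N)$, $\{(W_{1,t},W_{2,t})\}$ is IID zero-mean bivariate Gaussian with covariance $\mathsf{K}_W$, and $M_1,M_2,\{Z_t\},\{(W_{1,t},W_{2,t})\}$ are mutually independent. The output is $Y_t=X_{1,t}+X_{2,t}+Z_t$ and Transmitter $\nu\in\{1,2\}$ observes causally the feedback $V_{\nu,t}=Y_t+W_{\nu,t}$. A blocklength-$n$ code consists of encoders $X_{\nu,t}=\varphi_{\nu,t}(M_\nu,V_{\nu,1},\dots,V_{\nu,t-1})$, $t=1,\dots,n$, satisfying $\frac1n\sum_{t=1}^n\mathbb{E}[X_{\nu,t}^2]\le P_\nu$ ($\nu=1,2$), and a decoder $\phi:\mathbb{R}^n\to\mathcal{M}_1\times\mathcal{M}_2$.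 A pair $(R_1,R_2)$ is achievable if for every $\delta>0$ and all sufficiently large $n$ there is such a code with $\frac1n\log|\mathcal{M}_\nu|>R_\nu-\delta$ ($\nu=1,2$), and the error probabilities $\Pr[\phi(Y_1,\dots,Y_n)\ne(M_1,M_2)]$ tend to $0$ as $n\to\infty$. $\mathcal{C}_{\mathrm{NoisyFB}}(P_1,P_2,N,\mathsf{K}_W)$ is the set of achievable pairs, and $\mathcal C_{\mathrm{PerfectFB}}(P_1,P_2,N)=\mathcal C_{\mathrm{NoisyFB}}(P_1,P_2,N,\mathbf 0)$ with $\mathbf 0$ the $2\times 2$ zero matrix (noise-free feedback). $\mathrm{cl}$ denotes closure. *)

(* Defs.v *)
From HB Require Import structures.
From mathcomp Require Import all_boot all_order all_algebra.
From mathcomp Require Import all_classical all_reals all_analysis.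
Set Implicit Arguments. Unset Strict Implicit. Unset Printing Implicit Defensive.
Import Order.TTheory GRing.Theory Num.Theory.
Import numFieldNormedType.Exports.
Local Open Scope classical_set_scope.
Local Open Scope ring_scope.

(* Expectation of a nonnegative extended-real function of k IID standard
   Gaussian variables G_1..G_k, written as an iterated Lebesgue integral
   with respect to the N(0,1) law (equal to the product-measure integral
   by Tonelli for measurable nonnegative integrands). *)
Fixpoint gaussE {R : realType} (k : nat) : (k.-tuple R -> \bar R) -> \bar R :=
  match k with
  | 0 => fun f => f [tuple]
  | k'.+1 => fun f =>
      (\int[normal_prob (0:R) 1]_x gaussE (fun t : k'.-tuple R => f [tuple of x :: t]))%E
  end.

(* A code: message sets 'I_nM1, 'I_nM2; encoder nu at time t (0-indexed)
   maps the message and the list of the t past feedback outputs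
   V_{nu,1..t} to X_{nu,t+1}; decoder maps the received output list. *)
Record code (R : realType) := Code {
  nM1 : nat;
  nM2 : nat;
  enc1 : nat -> 'I_nM1 -> seq R -> R;
  enc2 : nat -> 'I_nM2 -> seq R -> R;
  dec : seq R -> 'I_nM1 * 'I_nM2 }.

(* state after t channel uses: (X1 list, X2 list, Y list, V1 list, V2 list) *)
Definition state (R : realType) := (seq R * seq R * seq R * seq R * seq R)%type.

(* The noise sequence g holds 3n IID standard Gaussians; at time t
     Z_t   = sqrt N * g_{3t}
     W_1t  = s1 * g_{3t+1}
     W_2t  = s2 * (rho * g_{3t+1} + sqrt(1 - rho^2) * g_{3t+2}),
   so that Z_t ~ N(0,N) and (W_1t,W_2t) is zero-mean Gaussian with
   covariance [[s1^2, rho s1 s2],[rho s1 s2, s2^2]], all independent. *)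
Fixpoint run (R : realType) (C : code R) (m1 : 'I_(nM1 C)) (m2 : 'I_(nM2 C))
    (N s1 s2 rho : R) (g : seq R) (t : nat) : state R :=
  match t with
  | 0 => ([::], [::], [::], [::], [::])
  | t'.+1 =>
    let: (x1s, x2s, ys, v1s, v2s) := run m1 m2 N s1 s2 rho g t' in
    let x1 := @enc1 R C t' m1 v1s in
    let x2 := @enc2 R C t' m2 v2s in
    let z := Num.sqrt N * nth 0 g (3 * t') in
    let w1 := s1 * nth 0 g (3 * t').+1 in
    let w2 := s2 * (rho * nth 0 g (3 * t').+1
                     + Num.sqrt (1 - rho ^+ 2) * nth 0 g (3 * t').+2) in
    let y := x1 + x2 + z in
    (rcons x1s x1, rcons x2s x2, rcons ys y, rcons v1s (y + w1), rcons v2s (y + w2))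
  end.

Definition outputs (R : realType) (C : code R) m1 m2 (N s1 s2 rho : R) g n : seq R :=
  (@run R C m1 m2 N s1 s2 rho g n).1.1.2.

Definition inputs1 (R : realType) (C : code R) m1 m2 (N s1 s2 rho : R) g n : seq R :=
  (@run R C m1 m2 N s1 s2 rho g n).1.1.1.1.

Definition inputs2 (R : realType) (C : code R) m1 m2 (N s1 s2 rho : R) g n : seq R :=
  (@run R C m1 m2 N s1 s2 rho g n).1.1.1.2.

Definition avgE (R : realType) (C : code R) (n : nat)
    (F : 'I_(nM1 C) -> 'I_(nM2 C) -> (3 * n).-tuple R -> \bar R) : \bar R :=
  (((nM1 C * nM2 C)%:R)^-1%:E *
    \sum_(m1 < nM1 C) \sum_(m2 < nM2 C) gaussE (F m1 m2))%E.

Definition err_prob (R : realType) (C : code R) (n : nat) (N s1 s2 rho : R) : \bar R :=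
  @avgE R C n (fun m1 m2 g =>
    ((@dec R C (@outputs R C m1 m2 N s1 s2 rho (tval g) n) != (m1, m2))%:R)%:E).

Definition power1 (R : realType) (C : code R) (n : nat) (N s1 s2 rho : R) : \bar R :=
  ((n%:R)^-1%:E * \sum_(t < n)
     @avgE R C n (fun m1 m2 g =>
       ((nth 0 (@inputs1 R C m1 m2 N s1 s2 rho (tval g) n) t) ^+ 2)%:E))%E.

Definition power2 (R : realType) (C : code R) (n : nat) (N s1 s2 rho : R) : \bar R :=
  ((n%:R)^-1%:E * \sum_(t < n)
     @avgE R C n (fun m1 m2 g =>
       ((nth 0 (@inputs2 R C m1 m2 N s1 s2 rho (tval g) n) t) ^+ 2)%:E))%E.

Definition valid_code (R : realType) (C : code R) (n : nat) (P1 P2 N s1 s2 rho : R) : Prop :=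
  [/\ (0 < nM1 C)%N /\ (0 < nM2 C)%N,
      (forall t m, measurable_fun [set: t.-tuple R] (fun v => @enc1 R C t m (tval v))) /\
      (forall t m, measurable_fun [set: t.-tuple R] (fun v => @enc2 R C t m (tval v))),
      (forall m, measurable [set v : n.-tuple R | @dec R C (tval v) = m]) &
      (power1 C n N s1 s2 rho <= P1%:E)%E /\ (power2 C n N s1 s2 rho <= P2%:E)%E].

(* C_NoisyFB(P1,P2,N,K_W) with K_W = [[s1^2, rho s1 s2],[rho s1 s2, s2^2]] *)
Definition NoisyFB (R : realType) (P1 P2 N s1 s2 rho : R) : set (R * R) :=
  [set r | forall delta : R, 0 < delta ->
     exists n0 : nat, exists Cs : nat -> code R,
       (forall n, (n0 <= n)%N ->
          [/\ valid_code (Cs n) n P1 P2 N s1 s2 rho,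
              r.1 - delta < ln (nM1 (Cs n))%:R / n%:R &
              r.2 - delta < ln (nM2 (Cs n))%:R / n%:R]) /\
       (forall eps : R, 0 < eps -> exists n1 : nat, forall n, (n1 <= n)%N ->
          (err_prob (Cs n) n N s1 s2 rho <= eps%:E)%E)].

Definition PerfectFB (R : realType) (P1 P2 N : R) : set (R * R) :=
  NoisyFB P1 P2 N 0 0 0.

(* Main.v *)
Require Import Defs.
From HB Require Import structures.
From mathcomp Require Import all_boot all_order all_algebra.
From mathcomp Require Import all_classical all_reals all_analysis.
From mathcomp Require Import measurable_realfun lra ring zify.
Import Order.TTheory GRing.Theory Num.Theory.
Import numFieldTopology.Exports numFieldNormedType.Exports.
Import Defs.
Local Open Scope classical_set_scope.
Local Open Scope ring_scope.
Set Implicit Arguments.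
Unset Strict Implicit.
Unset Printing Implicit Defensive.

(** No capacity formula is needed. The inclusion from left to right takes [K = 0] and
uses that the perfect-feedback region is closed. Conversely, let [r] be achievable
with perfect feedback and fix a code of large blocklength [n] and small error
probability.

- Robustness. After truncating the encoders, a Lusin-type approximation (with respect
  to the laws of the output under perfect feedback) replaces the encoders and the
  decoder by versions that do not react to small perturbations of their argument. The
  accuracies are chosen backwards in time, so that, for the same channel noise, the run
  with slightly noisy feedback stays close to the run with perfect feedback outside an
  event of small probability. Error probability and energies change arbitrarily little,
  uniformly over all small feedback covariances.

- Amplification. The new code is used as a memoryless channel on message pairs, in
  blocks followed by a bit of silence that pays for the increase in energy. Each
  transmitter encodes with a Gilbert-Varshamov code over its inner message set and adds
  a fixed dither word. The outer codes are invariant under adding constant words, hence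
  each of their coordinates is exactly uniform and the average powers are exactly those
  of the inner code. Averaged over the dithers, the pairs of inner messages are IID
  uniform, so a Chernoff bound makes the probability of more than a small fraction of
  wrong blocks exponentially small. *)

(** * Iterated Gaussian expectations *)

Section GaussianSequences.
Context {R : realType}.
Local Open Scope ereal_scope.

(** Runs of a code handle plain lists, which can be sliced without casts; measurability of a
    function of lists is therefore tested on one length at a time. *)
Definition seq_measurable d (U : measurableType d) (k : nat) (f : seq R -> U) :=
  measurable_fun [set: k.-tuple R] (fun t => f (tval t)).

(** The counterpart of [gaussE] on lists, suited to cutting the noise into blocks. The measure
    [gauss_prob] below gives the same expectation in a form suited to limit theorems and union
    bounds. *)
Fixpoint gauss_seq (k : nat) (f : seq R -> \bar R) : \bar R :=
  if k is k'.+1 then \int[normal_prob (0 : R) 1]_x gauss_seq k' (fun s => f (x :: s))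
  else f [::].

Lemma measurable_seq_comp d d' (T : measurableType d) (U : measurableType d')
    (k : nat) (f : seq R -> U) (F : T -> seq R) :
  (forall x, size (F x) = k) ->
  (forall i, (i < k)%N -> measurable_fun [set: T] (fun x => nth 0%R (F x) i)) ->
  seq_measurable k f -> measurable_fun [set: T] (fun x => f (F x)).
Proof.
move=> sF mF mf.
have Fk x : size (F x) == k by rewrite sF.
have mT : measurable_fun [set: T] (fun x => Tuple (Fk x)).
  apply/measurable_fun_tnthP => i /=.
  apply: eq_measurable_fun (mF i (ltn_ord i)) => x _ /=.
  by rewrite (tnth_nth 0%R).
exact: (measurableT_comp mf mT).
Qed.

Lemma measurable_nth (k i : nat) : seq_measurable k (fun s => nth (0 : R)%R s i).
Proof.
have [ik|ki] := ltnP i k.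
  apply: eq_measurable_fun (measurable_tnth (Ordinal ik)) => t _ /=.
  by rewrite (tnth_nth 0%R).
apply: eq_measurable_fun (measurable_cst (0 : R)%R) => t _ /=.
by rewrite nth_default// size_tuple.
Qed.

Lemma seq_measurable_slice d (U : measurableType d) (k m i : nat) (f : seq R -> U) :
  (i + m <= k)%N -> seq_measurable m f ->
  seq_measurable k (fun s => f (take m (drop i s))).
Proof.
move=> imk; apply: (@measurable_seq_comp _ _ _ _ m f
  (fun t : k.-tuple R => take m (drop i t))) => [t|j jm].
  by rewrite size_takel// size_drop size_tuple leq_subRL// (leq_trans (leq_addr _ _) imk).
apply: eq_measurable_fun (@measurable_nth k (i + j)) => t _ /=.
by rewrite nth_take// nth_drop.
Qed.

Lemma gaussE_seq (k : nat) (f : seq R -> \bar R) :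
  gaussE (fun t : k.-tuple R => f (tval t)) = gauss_seq k f.
Proof.
elim: k f => [//|k IH] f /=.
by apply: eq_integral => x _; rewrite -IH.
Qed.

Definition tuple_cons (k : nat) (p : measurableTypeR R * k.-tuple R) : k.+1.-tuple R :=
  [tuple of p.1 :: p.2].

Lemma measurable_tuple_cons k :
  measurable_fun [set: measurableTypeR R * k.-tuple R] (@tuple_cons k).
Proof. exact: measurable_cons. Qed.

HB.instance Definition _ k :=
  @isMeasurableFun.Build _ _ _ _ (@tuple_cons k) (@measurable_tuple_cons k).

Fixpoint gauss_prob (k : nat) : probability (k.-tuple R) R :=
  if k is k'.+1 then
    distribution (normal_prob (0 : R) 1 \x gauss_prob k') (@tuple_cons k')
  else dirac [tuple] : probability (0.-tuple R) R.


Lemma gauss_probS k : gauss_prob k.+1 =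
  distribution (normal_prob (0 : R) 1 \x gauss_prob k) (@tuple_cons k) :> (set _ -> _).
Proof. by []. Qed.

Lemma seq_measurable_cons d (U : measurableType d) k (f : seq R -> U) (x : R) :
  seq_measurable k.+1 f -> seq_measurable k (fun s => f (x :: s)).
Proof.
move=> mf.
have mc : measurable_fun [set: k.-tuple R] (fun t => [the k.+1.-tuple R of x :: t]).
  exact: measurable_cons.
exact: (measurableT_comp mf mc).
Qed.

(** Tonelli's theorem, applied one coordinate at a time along the construction of [gauss_prob] as
    the law of a head and an independent tail. *)
Lemma gauss_seqE (k : nat) (f : seq R -> \bar R) : (forall s, 0 <= f s) ->
  seq_measurable k f -> gauss_seq k f = \int[gauss_prob k]_t f (tval t).
Proof.
elim: k f => [|k IH] f f0 mf; first by rewrite /= integral_dirac// diracT mul1e.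
rewrite gauss_probS ge0_integral_distribution//.
have mf' : measurable_fun [set: measurableTypeR R * k.-tuple R]
    ((fun t : k.+1.-tuple R => f (tval t)) \o @tuple_cons k).
  exact: measurableT_comp.
rewrite (@fubini_tonelli1 _ _ _ _ _ _ _ _ mf' (fun t => f0 _)).
apply: eq_integral => x _; apply: (IH (fun s => f (x :: s))) => //.
exact: seq_measurable_cons.
Qed.

Lemma measurable_gauss_seq (k : nat) (f : seq R -> \bar R) : (forall s, 0 <= f s) ->
  seq_measurable k.+1 f ->
  measurable_fun [set: measurableTypeR R] (fun x => gauss_seq k (fun s => f (x :: s))).
Proof.
move=> f0 mf.
have mf' : measurable_fun [set: measurableTypeR R * k.-tuple R]
    ((fun t : k.+1.-tuple R => f (tval t)) \o @tuple_cons k).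
  exact: measurableT_comp.
have := @measurable_fun_fubini_tonelli_F _ _ _ _ R (gauss_prob k) _
  mf' (fun t => f0 _).
apply: eq_measurable_fun => x _; rewrite gauss_seqE//.
exact: seq_measurable_cons.
Qed.

Lemma gauss_seq_ge0 k (f : seq R -> \bar R) : (forall s, 0 <= f s) -> 0 <= gauss_seq k f.
Proof.
elim: k f => [|k IH] f f0 /=; first exact: f0.
by apply: integral_ge0 => x _; apply: IH.
Qed.

Lemma eq_gauss_seq k (f g : seq R -> \bar R) :
  (forall s, size s = k -> f s = g s) -> gauss_seq k f = gauss_seq k g.
Proof.
elim: k f g => [|k IH] f g fg /=; first exact: fg.
by apply: eq_integral => x _; apply: IH => s sk; apply: fg; rewrite /= sk.
Qed.

Lemma gauss_seqZl k (c : \bar R) (f : seq R -> \bar R) : 0 <= c ->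
  (forall s, 0 <= f s) -> seq_measurable k f ->
  gauss_seq k (fun s => c * f s) = c * gauss_seq k f.
Proof.
move=> c0 f0 mf; rewrite !gauss_seqE//.
- by rewrite ge0_integralZl.
- by move=> s; rewrite mule_ge0.
- exact: measurable_funeM.
Qed.

Lemma gauss_seq_cst k (c : \bar R) : gauss_seq k (fun=> c) = c.
Proof.
elim: k => [//|k IH] /=; rewrite (_ : (fun x => _) = cst c); last exact/funext.
by rewrite integral_cst//= probability_setT mule1.
Qed.

(** Independence of the first [a] and the last [b] coordinates. *)
Lemma gauss_seq_split a b (f h : seq R -> \bar R) :
  (forall s, 0 <= f s) -> (forall s, 0 <= h s) ->
  seq_measurable a f -> seq_measurable b h ->
  gauss_seq (a + b) (fun s => f (take a s) * h (drop a s)) =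
  gauss_seq a f * gauss_seq b h.
Proof.
elim: a f => [|a IH] f f0 h0 mf mh.
  rewrite add0n /= -gauss_seqZl//; apply: eq_gauss_seq => s _.
  by rewrite take0 drop0.
rewrite addSn /=.
transitivity (\int[normal_prob (0 : R) 1]_x
    (gauss_seq a (fun s => f (x :: s)) * gauss_seq b h)).
  apply: eq_integral => x _; apply: (IH (fun s => f (x :: s))) => //.
  exact: seq_measurable_cons.
rewrite ge0_integralZr//.
- exact: measurable_gauss_seq.
- by move=> x _; apply: gauss_seq_ge0.
- exact: gauss_seq_ge0.
Qed.

Lemma gauss_seq_drop a b (h : seq R -> \bar R) :
  (forall s, 0 <= h s) -> seq_measurable b h ->
  gauss_seq (a + b) (fun s => h (drop a s)) = gauss_seq b h.
Proof.
move=> h0 mh; have := @gauss_seq_split a b (cst 1) h (fun=> lee01) h0.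
rewrite gauss_seq_cst mul1e => <-//; last exact: measurable_cst.
by apply: eq_gauss_seq => s _; rewrite mul1e.
Qed.

Lemma gauss_seq_take a b (f : seq R -> \bar R) :
  (forall s, 0 <= f s) -> seq_measurable a f ->
  gauss_seq (a + b) (fun s => f (take a s)) = gauss_seq a f.
Proof.
move=> f0 mf; have := @gauss_seq_split a b f (cst 1) f0 (fun=> lee01).
rewrite gauss_seq_cst mule1 => <-//; last exact: measurable_cst.
by apply: eq_gauss_seq => s _; rewrite mule1.
Qed.

(** Independence of [k] consecutive blocks of length [m]; the [b] remaining coordinates integrate to
    one. This factorizes the exponential moment in the Chernoff bound. *)
Lemma gauss_seq_blocks m k b (f : nat -> seq R -> R) (e : nat -> R) :
  (forall j s, (0 <= f j s)%R) -> (forall j, seq_measurable m (f j)) ->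
  (forall j, gauss_seq m (fun s => (f j s)%:E) = (e j)%:E) ->
  gauss_seq (k * m + b)
    (fun s => (\prod_(j < k) f j (take m (drop (j * m) s)))%:E)
  = (\prod_(j < k) e j)%:E.
Proof.
elim: k f e => [|k IH] f e f0 mf fe.
  under eq_gauss_seq do rewrite big_ord0.
  by rewrite gauss_seq_cst big_ord0.
rewrite mulSn -addnA.
under eq_gauss_seq => s _.
  rewrite big_ord_recl mul0n drop0 EFinM.
  under eq_bigr do rewrite lift0 mulSn addnC -drop_drop.
  over.
rewrite (@gauss_seq_split _ _ (fun s => (f 0%N s)%:E) (fun s =>
  (\prod_(j < k) f j.+1 (take m (drop (j * m) s)))%:E)).
- by rewrite fe (IH (fun j => f j.+1) (fun j => e j.+1))// big_ord_recl EFinM.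
- by move=> s; rewrite lee_fin.
- by move=> s; rewrite lee_fin prodr_ge0.
- by apply/measurable_EFinP; exact: mf.
- apply/measurable_EFinP; apply: measurable_prod => j _.
  apply: seq_measurable_slice; last exact: mf.
  by rewrite (leq_trans _ (leq_addr _ _))// -mulSnr leq_mul2r ltn_ord orbT.
Qed.

End GaussianSequences.

(** * Stability of measurable maps under perturbation *)

Section SmallSets.
Context {R : realType} d (T : measurableType d) (P : probability T R).

(** Continuity from above at the empty set. Since [J] is finite, the maximum of the individual
    indices serves all families. *)
Lemma prob_nonincreasing_small (J : finType) (F : J -> (set T)^nat) :
  (forall j n, measurable (F j n)) -> (forall j n, F j n.+1 `<=` F j n) ->
  (forall j x, exists n, ~ F j n x) ->
  forall e : R, 0 < e -> exists n, forall j, (P (F j n) <= e%:E)%E.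
Proof.
move=> mF dF eF e e0.
have hF j : {homo F j : n m / (n <= m)%N >-> m `<=` n}.
  move=> n m; elim: m => [|m IH]; first by rewrite leqn0 => /eqP->.
  rewrite leq_eqVlt => /predU1P[->//|/IH]; exact: subset_trans (dF j m).
have small j : exists n, (P (F j n) <= e%:E)%E.
  have F0 : \bigcap_n F j n = set0.
    by apply/seteqP; split => // x Fx; have [n nF] := eF j x; apply: nF; apply: Fx.
  have P0 : (P (F j 0%N) < +oo)%E by rewrite ltey_eq fin_num_measure.
  have := @nonincreasing_cvg_mu _ _ _ P (F j) P0 (mF j).
  rewrite F0 measure0 => /(_ measurable0) cF.
  have {}cF := cF (fun n m nm => introT (subsetPset _ _) (hF j _ _ nm)).
  have e0' : (0 < e%:E)%E by rewrite lte_fin.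
  have [n _ /(_ n (leqnn n)) /ltW ?] :=
    cF _ (open_nbhs_nbhs (conj (@open_ereal_lt_ereal R e%:E) e0')).
  by exists n.
have [n Pn] := choice small.
exists (\max_j n j)%N => j; apply: le_trans (Pn j).
by apply: le_measure; rewrite ?inE//; apply: hF; exact: leq_bigmax.
Qed.

End SmallSets.

(* A Lusin-type statement obtained from the sigma-algebra of "stable" sets: up to
   an event of small probability, membership of [Y j] in [A] can be read off any
   sufficiently accurate version of [Y j], by testing membership in a perturbed set. *)
Section Stability.
Context {R : realType} d (T : measurableType d) (P : probability T R)
  (t : nat) (J : finType) (Y : J -> T -> t.-tuple R).
Hypothesis mY : forall j, measurable_fun [set: T] (Y j).

Definition tuple_close (D : R) (u v : t.-tuple R) :=
  forall i, `|tnth u i - tnth v i| < D.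

(** [D] and [A'] are common to all [j]; only the exceptional event [B j] varies. Later [j] is a pair
    of messages, of which a transmitter knows one and the decoder none, so a test must not depend on
    the pair. *)
Definition stable_approx (e D : R) (A A' : set (t.-tuple R)) (B : J -> set T) :=
  [/\ 0 < D, measurable A',
      forall j, measurable (B j) /\ (P (B j) <= e%:E)%E &
      forall j x y, ~ B j x -> tuple_close D y (Y j x) -> (A' y <-> A (Y j x))].

Definition stable_set (A : set (t.-tuple R)) := measurable A /\
  forall e : R, 0 < e -> exists D A' B, stable_approx e D A A' B.

Lemma tuple_closeW D D' u v : D <= D' -> tuple_close D u v -> tuple_close D' u v.
Proof. by move=> DD' uv i; apply: lt_le_trans (uv i) DD'. Qed.

Lemma measureU_le e1 e2 (B1 B2 : set T) : measurable B1 -> measurable B2 ->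
  (P B1 <= e1%:E)%E -> (P B2 <= e2%:E)%E -> (P (B1 `|` B2) <= (e1 + e2)%:E)%E.
Proof.
move=> m1 m2 P1 P2; apply: le_trans (measureU2 _ m1 m2) _.
by rewrite EFinD leeD.
Qed.

Lemma stable_set0 : stable_set set0.
Proof.
split=> // e e0; exists 1, set0, (fun=> set0); split => // j; split => //.
by rewrite measure0 lee_fin ltW.
Qed.

Lemma stable_setC A : stable_set A -> stable_set (~` A).
Proof.
move=> [mA sA]; split=> [|e e0]; first exact: measurableC.
have [D [A' [B [D0 mA' mB AA']]]] := sA e e0.
exists D, (~` A'), B; split => //; first exact: measurableC.
by move=> j x y Bx yY; split; apply: contra_not => /(AA' _ _ _ Bx yY).
Qed.

Lemma stable_setU A1 A2 : stable_set A1 -> stable_set A2 -> stable_set (A1 `|` A2).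
Proof.
move=> [mA1 sA1] [mA2 sA2]; split=> [|e e0]; first exact: measurableU.
have e2 : 0 < e / 2 by rewrite divr_gt0.
have [D1 [A1' [B1 [D10 mA1' mB1 AA1']]]] := sA1 _ e2.
have [D2 [A2' [B2 [D20 mA2' mB2 AA2']]]] := sA2 _ e2.
exists (Num.min D1 D2), (A1' `|` A2'), (fun j => B1 j `|` B2 j); split.
- by rewrite lt_min D10.
- exact: measurableU.
- move=> j; have [[m1 P1] [m2 P2]] := (mB1 j, mB2 j); split; first exact: measurableU.
  by rewrite [e]splitr measureU_le.
- have l1 : Num.min D1 D2 <= D1 by rewrite ge_min lexx.
  have l2 : Num.min D1 D2 <= D2 by rewrite ge_min lexx orbT.
  move=> j x y /not_orP[B1x B2x] yY.
  have c1 := AA1' _ _ _ B1x (tuple_closeW l1 yY).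
  have c2 := AA2' _ _ _ B2x (tuple_closeW l2 yY).
  by split=> -[/c1|/c2]; by [left|right].
Qed.

(** The union is replaced by a finite one; by continuity from above, what is lost has small
    probability under each of the finitely many laws. *)
Lemma stable_bigcup (F : (set (t.-tuple R))^nat) :
  (forall n, stable_set (F n)) -> stable_set (\bigcup_n F n).
Proof.
move=> sF; have mF n : measurable (F n) by case: (sF n).
split=> [|e e0]; first exact: bigcupT_measurable.
pose G n := \big[setU/set0]_(i < n) F i.
have sG n : stable_set (G n).
  rewrite /G; elim: n => [|n IH]; first by rewrite big_ord0; exact: stable_set0.
  by rewrite big_ord_recr; exact: stable_setU.
have GE n x : G n x <-> exists2 i, (i < n)%N & F i x by rewrite /G -bigcup_mkord; split.
have e2 : 0 < e / 2 by rewrite divr_gt0.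
pose E j n := Y j @^-1` ((\bigcup_n F n) `\` G n).
have mE j n : measurable (E j n).
  rewrite -[E j n]setTI; apply: mY => //; apply: measurableD.
    exact: bigcupT_measurable.
  by case: (sG n).
have [||n En] := @prob_nonincreasing_small _ _ _ P J E mE _ _ _ e2.
- move=> j n x [FYx nG]; split => // /GE[i im Fi]; apply: nG; apply/GE.
  by exists i => //; rewrite (ltn_trans im).
- move=> j x; have [[i _ Fi]|nF] := pselect ((\bigcup_n F n) (Y j x)).
    by exists i.+1 => -[_]; apply; apply/GE; exists i.
  by exists 0%N => -[].
have [D [A' [B [D0 mA' mB AA']]]] := (sG n).2 _ e2.
exists D, A', (fun j => B j `|` E j n); split => //.
- move=> j; have [m1 P1] := mB j; split; first exact: measurableU.
  by rewrite [e]splitr measureU_le.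
- move=> j x y /not_orP[Bx Ex] yY; split=> [/(AA' _ _ _ Bx yY)/GE[i _ Fi]|FY].
    by exists i.
  by apply/(AA' _ _ _ Bx yY); apply: contrapT => nG; apply: Ex.
Qed.

(* The threshold is moved by the accuracy [D], so that the boundary may carry mass. *)
Lemma stable_ray (i : 'I_t) (a : R) : stable_set [set y | a < tnth y i].
Proof.
have mray b : measurable [set y : t.-tuple R | b < tnth y i].
  have := @measurable_tnth _ R t i measurableT _ (measurable_itv `]b, +oo[).
  by rewrite setTI => /(eq_ind _ measurable); apply; apply/seteqP; split=> y /=;
    rewrite in_itv/= andbT.
split=> [//|e e0].
pose w n : R := n.+1%:R^-1.
have w0 n : 0 < w n by rewrite invr_gt0.
(* The test at [a + w n] can fail only if the coordinate lies in the strip above [a] of width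
   [w n *+ 2]. These strips shrink to the empty set. *)
pose E j n := Y j @^-1` ([set y | a < tnth y i] `\` [set y | a + w n *+ 2 < tnth y i]).
have mE j n : measurable (E j n).
  by rewrite -[E j n]setTI; apply: mY => //; apply: measurableD.
have [||n En] := @prob_nonincreasing_small _ _ _ P J E mE _ _ _ e0.
- move=> j n x [aY nY]; split => //=; apply: contra_not nY; apply: le_lt_trans.
  by rewrite lerD2l ler_pMn2r// lef_pV2 ?posrE// ler_nat.
- move=> j x; have [aY|aY] := ltP a (tnth (Y j x) i); last first.
    by exists 0%N => -[/=]; rewrite ltNge aY.
  have d0 : 0 < (tnth (Y j x) i - a) / 2 by rewrite divr_gt0// subr_gt0.
  have [n wn] : exists n, w n < (tnth (Y j x) i - a) / 2.
    by have [n] := ltr_add_invr d0; rewrite add0r; exists n.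
  exists n => -[_]; apply => /=; rewrite mulr2n; lra.
exists (w n), [set y | a + w n < tnth y i], (E^~ n); split => //.
move=> j x y Ex /(_ i); rewrite ltr_norml => /andP[l1 l2] /=.
split=> [l3|l3].
  have [//|l4] := ltP a (tnth (Y j x) i).
  by exfalso; lra.
have [l4|l4] := ltP (a + w n *+ 2) (tnth (Y j x) i); first by rewrite mulr2n in l4; lra.
by exfalso; apply: Ex; split => //=; rewrite ltNge l4.
Qed.

(** Two nested inductions on generated sigma-algebras: the one on tuples is generated by preimages
    of Borel sets under the coordinates, and the Borel sets by open rays. *)
Lemma measurable_stable A : measurable A -> stable_set A.
Proof.
move=> mA; apply: (@smallest_sub _ (sigma_algebra setT) _ stable_set _ _ A mA).
  split; [exact: stable_set0| |exact: stable_bigcup].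
  by move=> B /stable_setC; rewrite setTD.
move=> {}A {mA}; rewrite -bigcup_seq => -[i _ [B mB <-]]; rewrite setTI.
have {}mB : (ocitv (R:=R)).-sigma.-measurable B := mB.
move: mB; rewrite RGenOInfty.measurableE.
pose S := [set B : set R | stable_set ((@tnth t R)^~ i @^-1` B)].
move=> mB; apply: (@smallest_sub _ (sigma_algebra setT) _ S _ _ B mB).
  split; rewrite /S/=.
  - by rewrite preimage_set0; exact: stable_set0.
  - by move=> C; rewrite setTD preimage_setC; exact: stable_setC.
  - by move=> C sC; rewrite preimage_bigcup; exact: stable_bigcup.
move=> _ [a ->]; rewrite /S/=.
have -> : (@tnth t R)^~ i @^-1` `]a, +oo[ = [set y | a < tnth y i].
  by apply/seteqP; split => y /=; rewrite in_itv/= andbT.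
exact: stable_ray.
Qed.

Lemma stable_family (I : finType) (A : I -> set (t.-tuple R)) (e : R) : 0 < e ->
  (forall i, measurable (A i)) ->
  exists D A' B, [/\ 0 < D, forall j, measurable (B j) /\ (P (B j) <= e%:E)%E &
    forall i, stable_approx e D (A i) (A' i) B].
Proof.
move=> e0 mA.
suff H (r : seq I) (e' : R) : 0 < e' ->
    exists D A' B, 0 < D /\ (forall j, measurable (B j) /\ (P (B j) <= e'%:E)%E) /\
    forall i, i \in r -> stable_approx e' D (A i) (A' i) B.
  have [D [A' [B [D0 [mB DAB]]]]] := H (enum I) e e0.
  by exists D, A', B; split => // i; apply: DAB; rewrite mem_enum.
elim: r e' => [|i r IH] {e0}e e0.
  exists 1, (fun=> set0), (fun=> set0); split => //; split => // j; split => //.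
  by rewrite measure0 lee_fin ltW.
have e2 : 0 < e / 2 by rewrite divr_gt0.
have [D1 [A1' [B1 [D10 mA1' mB1 AA1']]]] := (measurable_stable (mA i)).2 _ e2.
have [D2 [A2' [B2 [D20 [mB2 AA2']]]]] := IH _ e2.
have l1 : Num.min D1 D2 <= D1 by rewrite ge_min lexx.
have l2 : Num.min D1 D2 <= D2 by rewrite ge_min lexx orbT.
have D0 : 0 < Num.min D1 D2 by rewrite lt_min D10.
exists (Num.min D1 D2), (fun k => if k == i then A1' else A2' k), (fun j => B1 j `|` B2 j).
have mB j : measurable (B1 j `|` B2 j) /\ (P (B1 j `|` B2 j) <= e%:E)%E.
  have [[m1 P1] [m2 P2]] := (mB1 j, mB2 j); split; first exact: measurableU.
  by rewrite [e]splitr measureU_le.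
split => //; split => // k; rewrite inE; case: eqVneq => [->|ki] /=.
  move=> _; split => // j x y /not_orP[B1x B2x] yY.
  exact: AA1' _ _ _ B1x (tuple_closeW l1 yY).
move=> /AA2'[_ mA' _ AA']; split => // j x y /not_orP[B1x B2x] yY.
exact: AA' _ _ _ B2x (tuple_closeW l2 yY).
Qed.

(** Each level set of [f] gets its own test. Off the exceptional event precisely one test accepts,
    and it names the value of [f]. *)
Lemma stable_fin (K : finType) (f : t.-tuple R -> K) (e : R) : 0 < e ->
  (forall k, measurable [set y | f y = k]) ->
  exists D f' B, [/\ 0 < D, forall k, measurable [set y | f' y = k],
    forall j, measurable (B j) /\ (P (B j) <= e%:E)%E &
    forall j x y, ~ B j x -> tuple_close D y (Y j x) -> f' y = f (Y j x)].
Proof.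
move=> e0 mf; pose k0 := f [tuple of nseq t 0].
have [D [A' [B [D0 mB DAB]]]] := stable_family e0 mf.
pose v y : {ffun K -> bool} := [ffun k => `[< A' k y >]].
(* If several tests accept, any accepted value is taken; if none does, the default is [k0]. Both
   happen only on the exceptional event or far from [Y j]. *)
pose h (b : {ffun K -> bool}) := odflt k0 [pick k | b k].
exists D, (fun y => h (v y)), B; split.
- by case: (DAB k0).
- move=> k.
  have mv b : measurable [set y | v y = b].
    rewrite (_ : [set y | v y = b] =
      \bigcap_(l in [set: K]) (if b l then A' l else ~` A' l)); last first.
      apply/seteqP; split=> y.
        by move=> <- l _; rewrite ffunE; case: asboolP.
      move=> H; apply/ffunP => l; rewrite ffunE; have := H l I.
      by case: (b l) => ?; [apply/asboolP | apply/asboolPn].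
    apply: fin_bigcap_measurable => // l _; have [_ mA _ _] := DAB l.
    by case: (b l) => //; exact: measurableC.
  rewrite (_ : [set y | h (v y) = k] = \bigcup_(b in [set b | h b = k]) [set y | v y = b]).
    exact: fin_bigcup_measurable.
  apply/seteqP; split=> y /=; first by move=> hk; exists (v y).
  by move=> [b /= hb vb]; rewrite vb.
- by case: (DAB k0).
- move=> j x y Bx yY; rewrite /h.
  have vE k : v y k = (f (Y j x) == k).
    have [_ _ _ /(_ _ _ _ Bx yY) H] := DAB k.
    by rewrite ffunE; apply/asboolP/eqP => /H.
  case: pickP => [k|/(_ (f (Y j x)))]; rewrite vE ?eqxx//.
  by move=> /eqP->.
Qed.

(** A staircase with [K] steps of height [eps] approximates [x] from below within [eps], unless [x]
    is so large that all the steps are climbed. *)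
Lemma sum_steps (eps x : R) (K : nat) : 0 < eps -> 0 <= x ->
  let S := \sum_(k < K) eps * (k.+1%:R * eps <= x)%R%:R in
  S <= x /\ (x - eps < S \/ S = K%:R * eps).
Proof.
move=> eps0 x0 /=; elim: K => [|K [IH1 IH2]].
  by rewrite big_ord0 mul0r; split => //; right.
rewrite big_ord_recr/=; case: (leP (K.+1%:R * eps) x) => Kx.
  rewrite mulr1; case: IH2 => [IH2|->].
    exfalso; move: Kx; rewrite -natr1 mulrDl mul1r.
    have : \sum_(k < K) eps * (k.+1%:R * eps <= x)%R%:R <= K%:R * eps.
      rewrite -[K in leRHS]card_ord -sumr_const mulr_suml; apply: ler_sum => k _.
      rewrite mul1r; apply: ler_piMr; first exact: ltW.
      by case: (_ <= x)%R.
    lra.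
  by split; [|right]; move: Kx; rewrite -natr1 mulrDl mul1r.
rewrite mulr0 addr0; split => //; left; case: IH2 => [//|->].
by move: Kx; rewrite -natr1 mulrDl mul1r; lra.
Qed.

(** The shifted function [f i + A] takes values in [[0, 2 * A]] and is quantized by a staircase; its
    finitely many superlevel sets are then replaced by stable tests. The number of steps bounds [f']
    everywhere, also where the tests are wrong. *)
Lemma stable_real (I : finType) (f : I -> t.-tuple R -> R) (A eps e : R) :
  0 <= A -> 0 < eps -> 0 < e -> (forall i, measurable_fun [set: t.-tuple R] (f i)) ->
  (forall i y, `|f i y| <= A) ->
  exists (D : R) (f' : I -> t.-tuple R -> R) (B : J -> set T), [/\ 0 < D,
    forall i, measurable_fun [set: t.-tuple R] (f' i) /\ forall y, `|f' i y| <= A + eps,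
    forall j, measurable (B j) /\ (P (B j) <= e%:E)%E &
    forall i j x y, ~ B j x -> tuple_close D y (Y j x) ->
      `|f' i y - f i (Y j x)| <= eps].
Proof.
move=> A0 eps0 e0 mf fA.
(* Enough steps to exceed [2 * A], but by at most one step: the first fact excludes saturation, the
   second bounds [f'] by [A + eps]. *)
pose K := (Num.truncn (2 * A / eps)).+1.
have q0 : 0 <= 2 * A / eps by rewrite divr_ge0 ?mulr_ge0// ltW.
have K1 : 2 * A < K%:R * eps by rewrite -ltr_pdivrMr// truncnS_gt.
have K2 : K%:R * eps <= 2 * A + eps.
  rewrite /K -natr1 mulrDl mul1r lerD2r -ler_pdivlMr//.
  by rewrite truncn_le.
pose S (p : I * 'I_K) := [set y : t.-tuple R | p.2.+1%:R * eps <= f p.1 y + A].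
have mS p : measurable (S p).
  have := mf p.1 measurableT _ (measurable_itv `[p.2.+1%:R * eps - A, +oo[).
  rewrite setTI => /(eq_ind _ measurable); apply; apply/seteqP; split=> y /=;
  by rewrite in_itv/= andbT lerBlDr.
have [D [S' [B [D0 mB DAB]]]] := stable_family e0 mS.
pose f' i y := - A + \sum_(k < K) eps * \1_(S' (i, k)) y.
exists D, f', B; split => //.
  move=> i; split.
    apply: measurable_funD => //; apply: measurable_sum => k.
    by apply: measurable_funM => //; apply: measurable_indic; case: (DAB (i, k)).
  move=> y; rewrite /f' ler_norml.
  have s0 : 0 <= \sum_(k < K) eps * \1_(S' (i, k)) y :> R.
    by apply: sumr_ge0 => k _; apply: mulr_ge0; [exact: ltW | rewrite indicE].
  have s1 : \sum_(k < K) eps * \1_(S' (i, k)) y <= K%:R * eps :> R.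
    rewrite -[K in leRHS]card_ord -sumr_const mulr_suml; apply: ler_sum => k _.
    rewrite mul1r; apply: ler_piMr; first exact: ltW.
    by rewrite indicE; case: (_ \in _).
  by apply/andP; split; lra.
move=> i j x y Bx yY; rewrite /f'.
have -> : \sum_(k < K) eps * \1_(S' (i, k)) y =
    \sum_(k < K) eps * (k.+1%:R * eps <= f i (Y j x) + A)%R%:R :> R.
  apply: eq_bigr => k _; rewrite indicE; congr (_ * _%:R); congr nat_of_bool.
  have [_ _ _ /(_ _ _ _ Bx yY) H] := DAB (i, k).
  by apply/idP/idP => [/set_mem/H//|?]; apply/mem_set/H.
have := fA i (Y j x); rewrite ler_norml => /andP[fl fu].
have x0 : 0 <= f i (Y j x) + A by lra.
have [] := @sum_steps eps (f i (Y j x) + A) K eps0 x0.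
set S0 := \sum_(k < K) _ => S1 S2.
rewrite ler_norml; apply/andP; split; last by lra.
by case: S2 => S2; [|rewrite S2 in S1 *]; lra.
Qed.

End Stability.

Section StabilitySeq.
Context {R : realType} d (T : measurableType d) (P : probability T R)
  (t : nat) (J : finType) (Y : J -> T -> seq R).
Hypothesis sY : forall j x, size (Y j x) = t.
Hypothesis mY : forall j i, measurable_fun [set: T] (fun x => nth 0 (Y j x) i).

Definition seq_close (D : R) (u v : seq R) :=
  forall i, (i < t)%N -> `|nth 0 u i - nth 0 v i| < D.

Let Yt j x : t.-tuple R := Tuple (introT eqP (sY j x)).

Let mYt j : measurable_fun [set: T] (Yt j).
Proof.
apply/measurable_fun_tnthP => i /=.
by apply: eq_measurable_fun (mY j i) => x _ /=; rewrite (tnth_nth 0).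
Qed.

(** Lists of the wrong length are sent to the zero tuple, so bounds known on tuples carry over to
    all lists. *)
Let tup (y : seq R) : t.-tuple R := insubd [tuple of nseq t 0] y.

Let tupK (y : t.-tuple R) : tup (tval y) = y.
Proof. by apply: val_inj; rewrite val_insubd size_tuple eqxx. Qed.

Let close_tup (D : R) y j x : size y = t -> seq_close D y (Y j x) ->
  tuple_close D (tup y) (Yt j x).
Proof.
move=> sy yY i; rewrite !(tnth_nth 0) val_insubd sy eqxx.
exact: yY.
Qed.

Lemma stable_real_seq (I : finType) (f : I -> seq R -> R) (A eps e : R) :
  0 <= A -> 0 < eps -> 0 < e -> (forall i, seq_measurable t (f i)) ->
  (forall i y, `|f i y| <= A) ->
  exists (D : R) (f' : I -> seq R -> R) (B : J -> set T), [/\ 0 < D,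
    forall i, seq_measurable t (f' i) /\ forall y, `|f' i y| <= A + eps,
    forall j, measurable (B j) /\ (P (B j) <= e%:E)%E &
    forall i j x y, ~ B j x -> size y = t -> seq_close D y (Y j x) ->
      `|f' i y - f i (Y j x)| <= eps].
Proof.
move=> A0 eps0 e0 mf fA.
have [D [f' [B [D0 mf' mB H]]]] :=
  @stable_real _ _ _ P _ _ _ mYt _ (fun i v => f i (tval v)) _ _ _
  A0 eps0 e0 mf (fun i v => fA i (tval v)).
exists D, (fun i y => f' i (tup y)), B; split => //.
  move=> i; split; last by move=> y; apply: (mf' i).2.
  by apply: eq_measurable_fun (mf' i).1 => y _; rewrite tupK.
by move=> i j x y Bx sy yY; apply: (H i j x (tup y) Bx); apply: close_tup.
Qed.

Lemma stable_fin_seq (K : finType) (f : seq R -> K) (e : R) : 0 < e ->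
  (forall k, measurable [set y : t.-tuple R | f (tval y) = k]) ->
  exists (D : R) (f' : seq R -> K) (B : J -> set T), [/\ 0 < D,
    forall k, measurable [set y : t.-tuple R | f' (tval y) = k],
    forall j, measurable (B j) /\ (P (B j) <= e%:E)%E &
    forall j x y, ~ B j x -> size y = t -> seq_close D y (Y j x) -> f' y = f (Y j x)].
Proof.
move=> e0 mf.
have [D [f' [B [D0 mf' mB H]]]] :=
  @stable_fin _ _ _ P _ _ _ mYt _ (fun v => f (tval v)) _ e0 mf.
exists D, (fun y => f' (tup y)), B; split => //.
  move=> k; rewrite (_ : mkset _ = [set y | f' y = k])//.
  by apply/seteqP; split => y /=; rewrite tupK.
by move=> j x y Bx sy yY; apply: (H j x (tup y) Bx); apply: close_tup.
Qed.

End StabilitySeq.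

(** * Truncation of square-integrable inputs and control on exceptional events *)

Section Truncation.
Context {R : realType} d (T : measurableType d) (P : probability T R).

(** Square-integrability makes the tail second moments vanish, so the tail probability is smaller
    than any multiple of the inverse square of the level. The factor [(A + 1) ^+ 2] is the energy
    that an input bounded by [A + 1] can spend on such an event. *)
Lemma truncation_level (I : finType) (X : I -> T -> R) :
  (forall i, measurable_fun [set: T] (X i)) ->
  (forall i, (\int[P]_x (X i x ^+ 2)%:E < +oo)%E) ->
  forall b : R, 0 < b -> exists A : R, 0 <= A /\
    forall i, (P [set x | (A < `|X i x|)%R] <= (b / (A + 1) ^+ 2)%:E)%E.
Proof.
move=> mX iX b b0.
have mS i (A : R) : measurable [set x | A < `|X i x|].
  have mn : measurable_fun [set: T] (fun x => `|X i x|) by exact: measurableT_comp.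
  move: mn => /(_ measurableT _ (measurable_itv `]A, +oo[)); rewrite setTI.
  by move=> /(eq_ind _ measurable); apply; apply/seteqP; split=> y /=; rewrite in_itv/= andbT.
pose f i (n : nat) x := (X i x ^+ 2 * \1_[set x | n%:R < `|X i x|] x)%:E.
have X2m i : measurable_fun [set: T] (fun x => (X i x ^+ 2)%:E).
  by apply/measurable_EFinP; exact: measurable_funX.
have mf i n : measurable_fun [set: T] (f i n).
  apply/measurable_EFinP; apply: measurable_funM; first exact: measurable_funX.
  exact: measurable_indic.
have f0 i n x : 0 <= X i x ^+ 2 * \1_[set x | n%:R < `|X i x|] x.
  by rewrite mulr_ge0 ?sqr_ge0// indicE.
have cvgf i : (\int[P]_x f i n x)%E @[n --> \oo] --> (0 : \bar R)%E.
  have := @dominated_cvg _ _ _ P setT measurableT (f i) (cst 0%E)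
    (fun x => (X i x ^+ 2)%:E) (mf i).
  rewrite integral0; apply => //.
  - move=> x _; apply: cvg_near_cst.
    near=> n; rewrite /f indicE memNset ?mulr0//=; apply/negP; rewrite -leNgt.
    near: n; exact: nbhs_infty_ger.
  - by apply/integrableP; split => //; under eq_integral do rewrite gee0_abs ?lee_fin ?sqr_ge0//.
  - move=> n x _; rewrite gee0_abs ?lee_fin ?f0//.
    by apply: ler_piMr; [exact: sqr_ge0 | rewrite indicE; case: (_ \in _)].
(* The factor 4 comes from [(k + 1) ^ 2 <= 4 * k ^ 2] for [k >= 1]; this is why a positive level is
   chosen next. *)
have b4 : (0 < (b / 4)%:E)%E by rewrite lte_fin divr_gt0.
have [k [k0 Hk]] : exists n : nat, (0 < n)%N /\ forall i, (\int[P]_x f i n x <= (b / 4)%:E)%E.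
  have F1 : \forall n \near \oo, forall i, (\int[P]_x f i n x <= (b / 4)%:E)%E.
    refine (filter_forall eventually_filter _) => j.
    have [m _ Hm] := cvgf j _ (open_nbhs_nbhs (conj (@open_ereal_lt_ereal R _) b4)).
    by exists m => // l ml; apply: ltW; exact: Hm l ml.
  have [m _ /(_ m (leqnn m))[? ?]] := filterI (nbhs_infty_gt 0%N) F1.
  by exists m.
exists k%:R; split => // i.
have k1 : 1 <= k%:R :> R by rewrite ler1n.
have k2 : (0 < ((k%:R + 1) ^+ 2 : R)%:E)%E by rewrite lte_fin exprn_gt0//; lra.
rewrite -(lee_pmul2l _ k2)//.
rewrite -EFinM mulrCA divff ?mulr1; last by rewrite gt_eqF// exprn_gt0//; lra.
apply: (@le_trans _ _ (4%:E * \int[P]_x f i k x)%E); last first.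
  rewrite (_ : b%:E = 4%:E * (b / 4)%:E)%E; first by rewrite lee_pmul2l// lte_fin.
  by rewrite -EFinM mulrC divfK.
rewrite (_ : P _ = \int[P]_x (\1_[set x | k%:R < `|X i x|] x)%:E)%E; last first.
  by rewrite integral_indic// setIT.
have mI : measurable_fun [set: T] (fun x => (\1_[set x | k%:R < `|X i x|] x : R)%:E).
  by apply/measurable_EFinP; exact: measurable_indic.
rewrite -!ge0_integralZl//.
apply: ge0_le_integral => //.
- exact: measurable_funeM.
- exact: measurable_funeM.
- move=> x _; rewrite -!EFinM lee_fin mulrA indicE.
  case: (boolP (x \in _)) => [/set_mem/= kX|_]; last by rewrite !mulr0.
  rewrite !mulr1 -[X i x ^+ 2]real_normK ?num_real//.
  have : k%:R ^+ 2 <= `|X i x| ^+ 2 by rewrite ler_sqr ?nnegrE//; exact: ltW.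
  rewrite !expr2; nra.
- by move=> x _; rewrite lee_fin f0.
Unshelve. all: by end_near. Qed.

(** Off [B] the two functions are compared pointwise; on [B] only the bound [K] of [h'] is used, so
    [h] may be unbounded. *)
Lemma expectation_le_good (h h' : T -> R) (B : set T) (b c K : R) :
  measurable_fun [set: T] h -> measurable_fun [set: T] h' ->
  (forall x, 0 <= h x) -> (forall x, 0 <= h' x) ->
  measurable B -> (P B <= b%:E)%E -> 0 <= c -> 0 <= K ->
  (forall x, ~ B x -> h' x <= h x + c) -> (forall x, h' x <= K) ->
  (\int[P]_x (h' x)%:E <= \int[P]_x (h x)%:E + (c + K * b)%:E)%E.
Proof.
move=> mh mh' h0 h'0 mB Pb c0 K0 hh' hK.
have mI : measurable_fun [set: T] (fun x => (\1_B x : R)%:E).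
  by apply/measurable_EFinP; exact: measurable_indic.
have mKI : measurable_fun [set: T] (fun x => K%:E * (\1_B x : R)%:E)%E.
  exact: measurable_funeM.
have KI0 x : (0 <= K%:E * (\1_B x : R)%:E)%E by rewrite -EFinM lee_fin mulr_ge0// indicE.
have mcKI : measurable_fun [set: T] (fun x => c%:E + K%:E * (\1_B x : R)%:E)%E.
  exact: emeasurable_funD.
have cKI0 x : (0 <= c%:E + K%:E * (\1_B x : R)%:E)%E by rewrite adde_ge0.
have mhE : measurable_fun [set: T] (fun x => (h x)%:E) by exact/measurable_EFinP.
apply: (@le_trans _ _ (\int[P]_x ((h x)%:E + (c%:E + K%:E * (\1_B x : R)%:E)))%E).
  apply: ge0_le_integral => //.
  - by move=> x _; rewrite lee_fin.
  - exact/measurable_EFinP.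
  - exact: emeasurable_funD.
  - move=> x _; rewrite -EFinM -!EFinD lee_fin indicE.
    case: (boolP (x \in B)) => [_|/negP xB]; last first.
      by rewrite mulr0 addr0; apply: hh' => Bx; apply: xB; exact: mem_set.
    by rewrite mulr1 (le_trans (hK x))// addrA lerDr addr_ge0.
rewrite ge0_integralD//; last by move=> x _; rewrite lee_fin.
rewrite leeD2l// ge0_integralD//.
rewrite integral_cst//= probability_setT mule1 EFinD leeD2l//.
rewrite ge0_integralZl//.
rewrite integral_indic// setIT EFinM.
by apply: lee_wpmul2l => //; rewrite lee_fin.
Qed.

Lemma prob_bigsetU_le (F : nat -> set T) m (b : R) :
  (forall i, measurable (F i)) -> (forall i, (i < m)%N -> (P (F i) <= b%:E)%E) ->
  (P (\big[setU/set0]_(i < m) F i) <= (m%:R * b)%:E)%E.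
Proof.
move=> mF Fb; apply: le_trans (Boole_inequality _ _) _ => [i _//|].
apply: (@le_trans _ _ (\sum_(i < m) b%:E)%E).
  by apply: lee_sum => i _; apply: Fb.
by rewrite sumEFin sumr_const card_ord mulr_natl.
Qed.

End Truncation.

(** * Trajectories of a code *)

Section Trajectories.
Context {R : realType} (C : code R).
Variables (m1 : 'I_(nM1 C)) (m2 : 'I_(nM2 C)) (N s1 s2 rho : R).

Definition fbnoise1 (g : seq R) (t : nat) := s1 * nth 0 g (3 * t).+1.
Definition fbnoise2 (g : seq R) (t : nat) :=
  s2 * (rho * nth 0 g (3 * t).+1 + Num.sqrt (1 - rho ^+ 2) * nth 0 g (3 * t).+2).

Definition feedback1 g t := (run m1 m2 N s1 s2 rho g t).1.2.
Definition feedback2 g t := (run m1 m2 N s1 s2 rho g t).2.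
Definition sent1 g t := enc1 t m1 (feedback1 g t).
Definition sent2 g t := enc2 t m2 (feedback2 g t).
Definition received g t := sent1 g t + sent2 g t + Num.sqrt N * nth 0 g (3 * t).

Lemma run_mkseq g t : run m1 m2 N s1 s2 rho g t =
  (mkseq (sent1 g) t, mkseq (sent2 g) t, mkseq (received g) t,
   mkseq (fun i => received g i + fbnoise1 g i) t,
   mkseq (fun i => received g i + fbnoise2 g i) t).
Proof.
elim: t => [//|t IH]; rewrite !mkseqS /received /sent1 /sent2 /feedback1 /feedback2.
by rewrite /= IH.
Qed.

Lemma outputs_mkseq g t : outputs m1 m2 N s1 s2 rho g t = mkseq (received g) t.
Proof. by rewrite /outputs run_mkseq. Qed.

Lemma inputs1_mkseq g t : inputs1 m1 m2 N s1 s2 rho g t = mkseq (sent1 g) t.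
Proof. by rewrite /inputs1 run_mkseq. Qed.

Lemma inputs2_mkseq g t : inputs2 m1 m2 N s1 s2 rho g t = mkseq (sent2 g) t.
Proof. by rewrite /inputs2 run_mkseq. Qed.

Lemma feedback1E g t : feedback1 g t = mkseq (fun i => received g i + fbnoise1 g i) t.
Proof. by rewrite /feedback1 run_mkseq. Qed.

Lemma feedback2E g t : feedback2 g t = mkseq (fun i => received g i + fbnoise2 g i) t.
Proof. by rewrite /feedback2 run_mkseq. Qed.

Hypothesis me1 : forall t m, seq_measurable t (@enc1 R C t m).
Hypothesis me2 : forall t m, seq_measurable t (@enc2 R C t m).

Lemma measurable_fbnoise1 k t : seq_measurable k (fbnoise1^~ t).
Proof. by apply: measurable_funM => //; exact: measurable_nth. Qed.

Lemma measurable_fbnoise2 k t : seq_measurable k (fbnoise2^~ t).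
Proof.
apply: measurable_funM => //; apply: measurable_funD; apply: measurable_funM => //;
exact: measurable_nth.
Qed.

(** Causality: the inputs at time [t] are measurable functions of the outputs and feedback noises at
    earlier times. *)
Lemma measurable_trajectory k t :
  [/\ seq_measurable k (sent1^~ t), seq_measurable k (sent2^~ t) &
      seq_measurable k (received^~ t)].
Proof.
elim/ltn_ind: t => t IH.
have mr i : (i < t)%N -> seq_measurable k (received^~ i) by move=> /IH[].
have m1' : seq_measurable k (sent1^~ t).
  apply: (@measurable_seq_comp _ _ _ _ _ t _ (fun g : k.-tuple R => feedback1 g t)) => //.
  - by move=> g; rewrite feedback1E size_mkseq.
  - move=> i it; under eq_fun do rewrite feedback1E nth_mkseq//.
    by apply: measurable_funD; [exact: mr|exact: measurable_fbnoise1].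
have m2' : seq_measurable k (sent2^~ t).
  apply: (@measurable_seq_comp _ _ _ _ _ t _ (fun g : k.-tuple R => feedback2 g t)) => //.
  - by move=> g; rewrite feedback2E size_mkseq.
  - move=> i it; under eq_fun do rewrite feedback2E nth_mkseq//.
    by apply: measurable_funD; [exact: mr|exact: measurable_fbnoise2].
split => //; apply: measurable_funD; first exact: measurable_funD.
by apply: measurable_funM => //; exact: measurable_nth.
Qed.

End Trajectories.

(** * Robust codes *)

Section CodeStatistics.
Context {R : realType} (C : code R) (n : nat) (N s1 s2 rho : R).

(** Kept separate for each message pair and each time, before any averaging: the robust code is
    controlled at this level. *)
Definition energy1 m1 m2 t := gauss_seq (3 * n)
  (fun g => (sent1 (C := C) m1 m2 N s1 s2 rho g t ^+ 2)%:E).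
Definition energy2 m1 m2 t := gauss_seq (3 * n)
  (fun g => (sent2 (C := C) m1 m2 N s1 s2 rho g t ^+ 2)%:E).
Definition error m1 m2 := gauss_seq (3 * n)
  (fun g => ((@dec R C (outputs (C := C) m1 m2 N s1 s2 rho g n) != (m1, m2))%:R)%:E).

Definition measurable_encoders :=
  (forall t m, seq_measurable t (@enc1 R C t m)) /\
  (forall t m, seq_measurable t (@enc2 R C t m)).
Definition measurable_decoder :=
  forall m, measurable [set v : n.-tuple R | @dec R C (tval v) = m].

Hypothesis mE : measurable_encoders.

Lemma measurable_error m1 m2 : measurable_decoder -> seq_measurable (3 * n)
  (fun g => (@dec R C (outputs (C := C) m1 m2 N s1 s2 rho g n) != (m1, m2))%:R : R).
Proof.
move=> mD.
have md : seq_measurable n (fun v => (@dec R C v != (m1, m2))%:R : R).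
  have := @measurable_indic _ _ R setT _ (measurableC (mD (m1, m2))).
  apply: eq_measurable_fun => v _; rewrite indicE; congr (nat_of_bool _)%:R.
  by apply/idP/idP => [/set_mem/eqP//|/eqP ?]; apply/mem_set.
apply: (@measurable_seq_comp _ _ _ _ _ n _
  (fun g : (3 * n).-tuple R => outputs m1 m2 N s1 s2 rho g n)) md.
- by move=> g; rewrite outputs_mkseq size_mkseq.
- move=> i i_n; under eq_fun do rewrite outputs_mkseq nth_mkseq//.
  by have [] := measurable_trajectory m1 m2 N s1 s2 rho mE.1 mE.2 (3 * n) i.
Qed.

Lemma energy1E m1 m2 t : energy1 m1 m2 t =
  (\int[gauss_prob (3 * n)]_g (sent1 (C := C) m1 m2 N s1 s2 rho g t ^+ 2)%:E)%E.
Proof.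
rewrite /energy1 gauss_seqE// => [g|]; first by rewrite lee_fin sqr_ge0.
apply/measurable_EFinP; apply: measurable_funX.
by have [] := measurable_trajectory m1 m2 N s1 s2 rho mE.1 mE.2 (3 * n) t.
Qed.

Lemma energy2E m1 m2 t : energy2 m1 m2 t =
  (\int[gauss_prob (3 * n)]_g (sent2 (C := C) m1 m2 N s1 s2 rho g t ^+ 2)%:E)%E.
Proof.
rewrite /energy2 gauss_seqE// => [g|]; first by rewrite lee_fin sqr_ge0.
apply/measurable_EFinP; apply: measurable_funX.
by have [] := measurable_trajectory m1 m2 N s1 s2 rho mE.1 mE.2 (3 * n) t.
Qed.

Lemma errorE m1 m2 : measurable_decoder -> error m1 m2 =
  (\int[gauss_prob (3 * n)]_g
    ((@dec R C (outputs (C := C) m1 m2 N s1 s2 rho g n) != (m1, m2))%:R)%:E)%E.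
Proof.
move=> mD; rewrite /error gauss_seqE//.
by apply/measurable_EFinP; exact: measurable_error.
Qed.

End CodeStatistics.

Section Clipping.
Context {R : realType}.

Definition clip (A x : R) := Num.max (- A) (Num.min A x).

Lemma clip_norm A x : 0 <= A -> `|clip A x| <= A.
Proof.
move=> A0; rewrite /clip ler_norml le_max lexx/= ge_max ge_min lexx/= andbT; lra.
Qed.

Lemma clip_id A x : `|x| <= A -> clip A x = x.
Proof. by rewrite ler_norml /clip => /andP[l1 l2]; rewrite min_r// max_r. Qed.

Lemma measurable_clip d (T : measurableType d) (A : R) (f : T -> R) :
  measurable_fun [set: T] f -> measurable_fun [set: T] (fun x => clip A (f x)).
Proof. by move=> mf; apply: measurable_maxr => //; apply: measurable_minr. Qed.

End Clipping.

Lemma sqr_near {R : realType} (A e u v : R) : `|v| <= A -> `|u - v| <= e / 4 ->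
  0 < e <= 1 -> u ^+ 2 <= v ^+ 2 + (2 * A + 1) * e.
Proof.
move=> vA uv /andP[e0 e1].
have -> : u ^+ 2 = v ^+ 2 + (2 * (v * (u - v)) + (u - v) ^+ 2) by ring.
rewrite lerD2l.
have h1 : v * (u - v) <= A * (e / 4).
  by apply: le_trans (ler_norm _) _; rewrite normrM ler_pM.
have h2 : (u - v) ^+ 2 <= e / 4.
  rewrite -real_normK ?num_real// expr2.
  have := ler_pM (normr_ge0 _) (normr_ge0 _) uv uv; nra.
have h3 : 0 <= A * e by rewrite mulr_ge0 ?(ltW e0)// (le_trans (normr_ge0 _) vA).
have -> : (2 * A + 1) * e = 2 * (A * e) + e by ring.
move: h1; rewrite mulrA; lra.
Qed.

Section RobustCode.
Context {R : realType} (C : code R) (n : nat) (N : R).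
Hypothesis mE : measurable_encoders C.
Hypothesis mD : measurable_decoder C n.
Local Notation T := ((3 * n).-tuple R).
Local Notation P := (gauss_prob (3 * n) : probability T R).
(** [J] indexes the laws of the output, one for each message pair. [I] indexes the encoding maps of
    both transmitters, each depending on its own message only. *)
Local Notation J := ('I_(nM1 C) * 'I_(nM2 C))%type.
Local Notation I := ('I_(nM1 C) + 'I_(nM2 C))%type.

Let x1 (j : J) (g : seq R) t := sent1 (C := C) j.1 j.2 N 0 0 0 g t.
Let x2 (j : J) (g : seq R) t := sent2 (C := C) j.1 j.2 N 0 0 0 g t.
Let y (j : J) (g : seq R) t := received (C := C) j.1 j.2 N 0 0 0 g t.

Lemma perfect_feedback1 (j : J) g t :
  feedback1 (C := C) j.1 j.2 N 0 0 0 g t = mkseq (y j g) t.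
Proof. by rewrite feedback1E; apply: eq_mkseq => i; rewrite /fbnoise1 mul0r addr0. Qed.

Lemma perfect_feedback2 (j : J) g t :
  feedback2 (C := C) j.1 j.2 N 0 0 0 g t = mkseq (y j g) t.
Proof. by rewrite feedback2E; apply: eq_mkseq => i; rewrite /fbnoise2 mul0r addr0. Qed.

Let m_traj (j : J) t := measurable_trajectory j.1 j.2 N 0 0 0 mE.1 mE.2 (3 * n) t.

Let f A t (i : I) (v : seq R) :=
  clip A (match i with inl m => @enc1 R C t m v | inr m => @enc2 R C t m v end).

(** Every time and every wanted accuracy [e] gets a tolerance [D] on the feedback. Packing the
    choices into one function [q] allows the tolerances to be defined by recursion afterwards. *)
Lemma robust_encoder_step (A b : R) : 0 <= A -> 0 < b ->
  exists q : nat * R -> R * (I -> seq R -> R) * (J -> set T),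
  forall t e, 0 < e <= 1 ->
    let: (D, F, B) := q (t, e) in
    [/\ 0 < D <= e,
        forall i, seq_measurable t (F i) /\ (forall v, `|F i v| <= A + 1),
        forall j, measurable (B j) /\ (P (B j) <= b%:E)%E &
        forall i j g v, ~ B j g -> size v = t ->
          seq_close t D v (mkseq (y j g) t) ->
          `|F i v - f A t i (mkseq (y j g) t)| <= e / 4].
Proof.
move=> A0 b0.
pose rel (te : nat * R) (q : R * (I -> seq R -> R) * (J -> set T)) :=
  0 < te.2 <= 1 -> [/\ 0 < q.1.1 <= te.2,
        forall i, seq_measurable te.1 (q.1.2 i) /\ (forall v, `|q.1.2 i v| <= A + 1),
        forall j, measurable (q.2 j) /\ (P (q.2 j) <= b%:E)%E &
        forall i j g v, ~ q.2 j g -> size v = te.1 ->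
          seq_close te.1 q.1.1 v (mkseq (y j g) te.1) ->
          `|q.1.2 i v - f A te.1 i (mkseq (y j g) te.1)| <= te.2 / 4].
suff /choice[q qP] : forall te, exists q, rel te q.
  exists q => t e e01; have := qP (t, e) e01.
  by case: (q (t, e)) => -[D F] B.
move=> [t e]; have [/andP[e0 e1]|] := boolP (0 < e <= 1); last first.
  by move=> /negP H; exists (0, fun _ _ => 0, fun=> set0) => /H.
have [|||||D [F [B [D0 mF mB H]]]] := @stable_real_seq R _ T P t _
  (fun (j : J) (g : T) => mkseq (y j g) t) _ _ _ (f A t) A (e / 4) b A0 _ b0.
- by move=> j g; rewrite size_mkseq.
- move=> j i; have [it|ti] := ltnP i t; last first.
    apply: eq_measurable_fun (measurable_cst (0 : R)) => g _.
    by rewrite nth_default// size_mkseq.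
  by under eq_fun do rewrite nth_mkseq//; have [] := m_traj j i.
- by rewrite divr_gt0.
- by move=> [m|m]; apply: measurable_clip; [exact: mE.1|exact: mE.2].
- by move=> i v; exact: clip_norm.
(* The minimum with [e] makes tolerances shrink going backwards in time. *)
exists (Num.min D e, F, B) => _ /=; split => //.
- by rewrite lt_min D0 e0 ge_min lexx orbT.
- move=> i; have [? Fb] := mF i; split => // v.
  by apply: le_trans (Fb v) _; lra.
- move=> i j g v Bg sv vY; apply: H => //.
  by move=> k kt; apply: lt_le_trans (vY k kt) _; rewrite ge_min lexx.
Qed.

Definition noise_large (L : R) : set T := [set g | exists i, L < `|tnth g i|].

Lemma noise_bounded (b : R) : 0 < b -> exists L : R, [/\ 0 <= L,
  measurable (noise_large L) & (P (noise_large L) <= b%:E)%E].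
Proof.
move=> b0.
have mW (L : R) : measurable (noise_large L).
  rewrite (_ : noise_large L = \bigcup_(i in [set: 'I_(3 * n)]) [set g | L < `|tnth g i|]).
    apply: fin_bigcup_measurable => // i _.
    have mn : measurable_fun [set: T] (fun g => `|tnth g i|).
      by apply: measurableT_comp => //; exact: measurable_tnth.
    have := mn measurableT _ (measurable_itv `]L, +oo[); rewrite setTI.
    by move=> /(eq_ind _ measurable); apply; apply/seteqP; split=> g /=;
      rewrite in_itv/= andbT.
  by apply/seteqP; split=> g /= [i]; exists i.
have [|||L PL] := @prob_nonincreasing_small R _ T P unit
    (fun _ k => noise_large k%:R) _ _ _ b b0 => [_ k|_ k g|_ g|].
- exact: mW.
- by move=> [i gi]; exists i; apply: le_lt_trans gi; rewrite ler_nat.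
- exists (Num.truncn (\sum_i `|tnth g i|)).+1 => -[i]; apply/negP; rewrite -leNgt.
  apply: le_trans (ltW (truncnS_gt _)).
  by rewrite (bigD1 i)//= lerDl sumr_ge0.
by exists L%:R; split => //; exact: PL tt.
Qed.

(** Clipped encoders and the decoder are replaced by stable versions, with tolerances fixed from the
    decoder back to the first channel use. The threshold [sig] is chosen before the covariance and
    the messages. *)
Lemma robust_code :
  (forall m1 m2 t, (t < n)%N -> (energy1 (C := C) n N 0 0 0 m1 m2 t < +oo)%E) ->
  (forall m1 m2 t, (t < n)%N -> (energy2 (C := C) n N 0 0 0 m1 m2 t < +oo)%E) ->
  forall kap : R, 0 < kap ->
  exists e1 e2 de, let C' := @Code R (nM1 C) (nM2 C) e1 e2 de in
  [/\ measurable_encoders C', measurable_decoder C' n &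
  exists sig, 0 < sig /\ forall s1 s2 rho, 0 <= s1 <= sig -> 0 <= s2 <= sig ->
    -1 <= rho <= 1 -> forall m1 m2,
    (error (C := C') n N s1 s2 rho m1 m2 <= error (C := C) n N 0 0 0 m1 m2 + kap%:E)%E /\
    forall t, (t < n)%N ->
      (energy1 (C := C') n N s1 s2 rho m1 m2 t <=
        energy1 (C := C) n N 0 0 0 m1 m2 t + kap%:E)%E /\
      (energy2 (C := C') n N s1 s2 rho m1 m2 t <=
        energy2 (C := C) n N 0 0 0 m1 m2 t + kap%:E)%E].
Proof.
move=> fin1 fin2 kap kap0.
(* There will be [3 * n + 2] exceptional events of probability at most [b0 / (A + 1) ^+ 2] each, so
   their total cost in energy is [kap / 2]. *)
pose b0 : R := kap / (2 * (3 * n + 2)%:R).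
have c0 : 0 < (3 * n + 2)%:R :> R by rewrite ltr0n addn2.
have b00 : 0 < b0 by rewrite divr_gt0// mulr_gt0.
pose X (ij : ('I_n * bool) * J) (g : T) :=
  if ij.1.2 then x1 ij.2 g ij.1.1 else x2 ij.2 g ij.1.1.
have mX ij : measurable_fun [set: T] (X ij).
  by case: ij => [[t []] j]; rewrite /X/=; have [] := m_traj j t.
have fX ij : (\int[P]_g (X ij g ^+ 2)%:E < +oo)%E.
  case: ij => [[t []] j]; rewrite /X/=.
  - by have := fin1 j.1 j.2 t (ltn_ord t); rewrite energy1E.
  - by have := fin2 j.1 j.2 t (ltn_ord t); rewrite energy2E.
have [A [A0 PA]] := truncation_level mX fX b00.
pose b : R := b0 / (A + 1) ^+ 2.
have A1 : 1 <= (A + 1) ^+ 2 by rewrite expr_ge1//; lra.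
have A10 : 0 < (A + 1) ^+ 2 by apply: lt_le_trans A1.
have b_gt0 : 0 < b by rewrite divr_gt0.
have bA : (A + 1) ^+ 2 * ((3 * n + 2)%:R * b) = kap / 2.
  rewrite /b /b0; field; apply/andP; split; lra.
have [L [L0 mW PW]] := noise_bounded b_gt0.
have [||Dd [de [Bd [Dd0 mde mBd Hde]]]] := @stable_fin_seq R _ T P n _
  (fun (j : J) (g : T) => mkseq (y j g) n) _ _ _ (@dec R C) b b_gt0 mD.
- by move=> j g; rewrite size_mkseq.
- move=> j i; have [it|ti] := ltnP i n; last first.
    apply: eq_measurable_fun (measurable_cst (0 : R)) => g _.
    by rewrite nth_default// size_mkseq.
  by under eq_fun do rewrite nth_mkseq//; have [] := m_traj j i.
have [q qP] := robust_encoder_step A0 b_gt0.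
(* Chosen so that, by [sqr_near], tracking errors change a squared input by at most
   [(2 * A + 1) * del], that is [kap / 2]. *)
pose del : R := kap / (2 * (2 * A + 1)).
have del0 : 0 < del by rewrite divr_gt0//; lra.
pose D_n := Num.min (Num.min Dd del) 1.
(* [dd k] is the tolerance at time [n - k]. It starts at what the decoder demands, and each step
   asks [q] which feedback tolerance yields the accuracy already fixed for the next time. Reindexed
   as [D], it increases with time. *)
pose dd := fix dd k := if k is k'.+1 then (q (n - k'.+1, dd k')%N).1.1 else D_n.
have dd01 k : 0 < dd k <= 1.
  elim: k => [|k /[dup] IH /andP[_ IH1]].
    by rewrite !lt_min Dd0 del0 ltr01/= ge_min lexx orbT.
  rewrite /=; have := qP (n - k.+1)%N (dd k) IH.
  case: (q _) => [[D F] B] [/andP[? DI] _ _ _] /=.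
  by apply/andP; split => //; apply: le_trans DI IH1.
have ddS k : dd k.+1 <= dd k.
  rewrite /=; have := qP (n - k.+1)%N (dd k) (dd01 k).
  by case: (q _) => [[D F] B] [/andP[? DI] _ _ _] /=.
have dd_mono k l : (k <= l)%N -> dd l <= dd k.
  elim: l => [|l IH]; first by rewrite leqn0 => /eqP->.
  by rewrite leq_eqVlt => /predU1P[->//|/IH]; apply: le_trans.
pose D t := dd (n - t)%N.
have D01 t : 0 < D t <= 1 by exact: dd01.
have D_mono s t : (s <= t)%N -> D s <= D t.
  by move=> st; apply: dd_mono; rewrite leq_sub2l.
pose Q t := q (t, D t.+1).
have QD t : (t < n)%N -> (Q t).1.1 = D t.
  move=> tn; rewrite /Q /D; have -> : (n - t = (n - t.+1).+1)%N by rewrite subnSK.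
  by rewrite /= subnSK// subKn// ltnW.
have QP t : [/\ 0 < (Q t).1.1 <= D t.+1,
    forall i, seq_measurable t ((Q t).1.2 i) /\ (forall v, `|(Q t).1.2 i v| <= A + 1),
    forall j, measurable ((Q t).2 j) /\ (P ((Q t).2 j) <= b%:E)%E &
    forall i j g v, ~ (Q t).2 j g -> size v = t ->
      seq_close t (Q t).1.1 v (mkseq (y j g) t) ->
      `|(Q t).1.2 i v - f A t i (mkseq (y j g) t)| <= D t.+1 / 4].
  by rewrite /Q; have := qP t (D t.+1) (D01 t.+1); case: (q _) => [[D' F] B].
exists (fun t m v => (Q t).1.2 (inl m) v), (fun t m v => (Q t).1.2 (inr m) v), de.
set C' := Code _ _ _.
have mE' : measurable_encoders C'.
  by split => t m; have [_ mF _ _] := QP t; [exact: (mF (inl m)).1|exact: (mF (inr m)).1].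
split => //.
(* When the noise variables are at most [L], a feedback noise is at most [2 * L] times this value,
   hence below [D 0 / 2]. *)
exists (D 0%N / (4 * (L + 1))); split.
  by rewrite divr_gt0// ?mulr_gt0//; have /andP[] := D01 0%N; lra.
move=> s1 s2 rho s1P s2P rhoP m1 m2; pose j : J := (m1, m2).
pose x1' g t := sent1 (C := C') m1 m2 N s1 s2 rho g t.
pose x2' g t := sent2 (C := C') m1 m2 N s1 s2 rho g t.
pose y' g t := received (C := C') m1 m2 N s1 s2 rho g t.
pose S1 t := [set g : T | A < `|x1 j g t|].
pose S2 t := [set g : T | A < `|x2 j g t|].
pose U0 t := (Q t).2 j `|` (S1 t `|` S2 t).
(* Three events for each time (failure of the stable encoders and one large input for each
   transmitter), then failure of the stable decoder and large noise. *)
pose U := (\big[setU/set0]_(t < n) U0 t) `|` (Bd j `|` noise_large L).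
have mS (h : T -> R) : measurable_fun [set: T] h -> measurable [set g | A < `|h g|].
  move=> mh; have mn : measurable_fun [set: T] (fun g => `|h g|) by exact: measurableT_comp.
  have := mn measurableT _ (measurable_itv `]A, +oo[); rewrite setTI.
  by move=> /(eq_ind _ measurable); apply; apply/seteqP; split=> g /=;
    rewrite in_itv/= andbT.
have mS1 t : measurable (S1 t) by apply: mS; have [] := m_traj j t.
have mS2 t : measurable (S2 t) by apply: mS; have [] := m_traj j t.
have mU0 t : measurable (U0 t).
  by apply: measurableU; [have [_ _ /(_ j)[]] := QP t|exact: measurableU].
have mBW : measurable (Bd j `|` noise_large L).
  by apply: measurableU => //; have [] := mBd j.
have mU : measurable U.
  by apply: measurableU => //; apply: bigsetU_measurable => t _.
have PU0 t : (t < n)%N -> (P (U0 t) <= (b + (b + b))%:E)%E.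
  move=> tn; have [_ _ /(_ j)[mB PB] _] := QP t.
  apply: measureU_le => //; first exact: measurableU.
  by apply: measureU_le => //; [exact: (PA ((Ordinal tn, true), j))
                              |exact: (PA ((Ordinal tn, false), j))].
have PU : (P U <= ((3 * n + 2)%:R * b)%:E)%E.
  have -> : (3 * n + 2)%:R * b = n%:R * (b + (b + b)) + (b + b).
    by rewrite natrD natrM; ring.
  apply: measureU_le => //; first by apply: bigsetU_measurable => t _.
    exact: prob_bigsetU_le.
  by apply: measureU_le => //; have [] := mBd j.
have wb (s w1 w2 a1 a2 : R) : 0 <= s <= D 0%N / (4 * (L + 1)) ->
    `|w1| <= L -> `|w2| <= L -> `|a1| <= 1 -> `|a2| <= 1 ->
    `|s * (a1 * w1 + a2 * w2)| < D 0%N / 2.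
  move=> /andP[s0 sD] w1L w2L a11 a21; rewrite normrM (ger0_norm s0).
  have sw : `|a1 * w1 + a2 * w2| <= 2 * L.
    apply: le_trans (ler_normD _ _) _; rewrite !normrM mulr2n mulrDl mul1r.
    by apply: lerD; rewrite -[leRHS]mul1r ler_pM.
  apply: (@le_lt_trans _ _ (D 0%N / (4 * (L + 1)) * (2 * L))); first by rewrite ler_pM.
  have /andP[D00 _] := D01 0%N.
  rewrite mulrAC ltr_pdivrMr; last by lra.
  by have := mulr_gt0 D00 (ltr01 : 0 < 1 :> R); nra.
have nthL (g : T) i : ~ noise_large L g -> `|nth 0 g i| <= L.
  move=> Wg; have [i_n|ni] := ltnP i (3 * n); last first.
    by rewrite nth_default ?normr0// size_tuple.
  rewrite leNgt; apply/negP => Lg; apply: Wg; exists (Ordinal i_n).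
  by rewrite (tnth_nth 0).
have rho1 : `|rho| <= 1 by rewrite ler_norml.
have sq1 : `|Num.sqrt (1 - rho ^+ 2)| <= 1.
  rewrite ger0_norm ?sqrtr_ge0// -[leRHS]sqrtr1 ler_sqrt//.
  by have := sqr_ge0 rho; lra.
(* Before time [t] the outputs are off by at most [D t / 2] and the feedback noise is below
   [D 0 / 2], so the feedback is within the tolerance [D t]. Each input is then off by at most
   [D t.+1 / 4], and the output by twice as much, the channel noise being the same in both runs. *)
have track (g : T) : ~ U g -> forall t, (t < n)%N ->
    [/\ `|x1' g t - x1 j g t| <= D t.+1 / 4, `|x2' g t - x2 j g t| <= D t.+1 / 4,
        `|x1 j g t| <= A, `|x2 j g t| <= A & `|y' g t - y j g t| <= D t.+1 / 2].
  move=> /not_orP[U0g /not_orP[_ Wg]]; elim/ltn_ind => t IH tn.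
  have /not_orP[Bg /not_orP[S1g S2g]] : ~ U0 t g.
    by move=> U0t; apply: U0g; rewrite -bigcup_mkord; exists t.
  have a1 : `|x1 j g t| <= A by rewrite leNgt; exact/negP.
  have a2 : `|x2 j g t| <= A by rewrite leNgt; exact/negP.
  have closeV (w : nat -> R) : (forall i, `|w i| < D 0%N / 2) ->
      seq_close t (Q t).1.1 (mkseq (fun i => y' g i + w i) t) (mkseq (y j g) t).
    move=> wP i it; rewrite !nth_mkseq// (QD _ tn).
    have [_ _ _ _ yi] := IH i it (ltn_trans it tn).
    rewrite addrAC; apply: le_lt_trans (ler_normD _ _) _.
    by have := wP i; have := D_mono _ _ it; have := D_mono 0%N t (leq0n _); lra.
  have c1 : seq_close t (Q t).1.1 (feedback1 (C := C') m1 m2 N s1 s2 rho g t)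
      (mkseq (y j g) t).
    rewrite feedback1E; apply: closeV => i; rewrite /fbnoise1.
    have := wb s1 (nth 0 g (3 * i).+1) 0 1 0 s1P (nthL _ _ Wg).
    by rewrite !mulr0 addr0 mul1r normr0 normr1; apply.
  have c2 : seq_close t (Q t).1.1 (feedback2 (C := C') m1 m2 N s1 s2 rho g t)
      (mkseq (y j g) t).
    rewrite feedback2E; apply: closeV => i; rewrite /fbnoise2.
    exact: wb _ _ _ _ _ s2P (nthL _ _ Wg) (nthL _ _ Wg) rho1 sq1.
  have [_ _ _ H] := QP t.
  have d1 : `|x1' g t - x1 j g t| <= D t.+1 / 4.
    have := H (inl m1) j g _ Bg _ c1; rewrite feedback1E size_mkseq -feedback1E.
    (* Off [U] the perfect-feedback input is at most [A], so clipping leaves it unchanged. *)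
    rewrite /f clip_id; last by rewrite -(perfect_feedback1 j); exact: a1.
    by rewrite -(perfect_feedback1 j); apply.
  have d2 : `|x2' g t - x2 j g t| <= D t.+1 / 4.
    have := H (inr m2) j g _ Bg _ c2; rewrite feedback2E size_mkseq -feedback2E.
    rewrite /f clip_id; last by rewrite -(perfect_feedback2 j); exact: a2.
    by rewrite -(perfect_feedback2 j); apply.
  split => //.
  have -> : y' g t - y j g t = (x1' g t - x1 j g t) + (x2' g t - x2 j g t).
    by rewrite /y' /y /received -/(x1' g t) -/(x2' g t) -/(x1 j g t) -/(x2 j g t); ring.
  by apply: le_trans (ler_normD _ _) _; lra.
have Dn : D n = D_n by rewrite /D subnn.
have DnP t : (t <= n)%N -> [/\ D t <= Dd, D t <= del & D t <= 1].
  move=> /D_mono; rewrite Dn /D_n !le_min => /andP[/andP[? ?] ?]; split => //.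
have kap2 : (3 * n + 2)%:R * b <= kap / 2.
  by rewrite -bA ler_peMl// mulr_ge0// ltW.
split.
  rewrite !errorE//.
  (* Off [U] the two decoders decide alike, whence the constant 0; on [U] an error indicator is at
     most 1. *)
  have := @expectation_le_good R _ T P
    (fun g => (@dec R C (outputs (C := C) m1 m2 N 0 0 0 g n) != (m1, m2))%:R)
    (fun g => (@dec R C' (outputs (C := C') m1 m2 N s1 s2 rho g n) != (m1, m2))%:R)
    U ((3 * n + 2)%:R * b) 0 1 _ _ _ _ mU PU (lexx _) ler01.
  rewrite add0r mul1r => H; apply: le_trans (H _ _ _ _ _ _) _ => //.
  - exact: measurable_error.
  - exact: measurable_error.
  - move=> g Ug; rewrite addr0.
    suff E : @dec R C' (outputs (C := C') m1 m2 N s1 s2 rho g n) =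
      @dec R C (outputs (C := C) m1 m2 N 0 0 0 g n).
      by rewrite E.
    rewrite !outputs_mkseq; move: (Ug) => /not_orP[_ /not_orP[Bg _]].
    change (de (mkseq (y' g) n) = @dec R C (mkseq (y j g) n)).
    apply: (Hde j g _ Bg); first by rewrite size_mkseq.
    move=> i i_n; rewrite !nth_mkseq//; have [_ _ _ _ yi] := track g Ug i i_n.
    apply: le_lt_trans yi _; have [+ _ _] := DnP i.+1 i_n.
    by have /andP[] := D01 i.+1; lra.
  - by move=> g; case: (_ != _).
  - by rewrite leeD2l// lee_fin; lra.
have kd : kap / 2 = (2 * A + 1) * del by rewrite /del; field; lra.
have sqle (u v e : R) : `|u - v| <= e / 4 -> `|v| <= A -> 0 < e -> e <= del -> e <= 1 ->
    u ^+ 2 <= v ^+ 2 + kap / 2.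
  move=> uv vA e0 ed e1; apply: le_trans (sqr_near vA uv _) _; first by rewrite e0.
  by rewrite lerD2l kd ler_wpM2l// addr_ge0// mulr_ge0.
have x1b (g : seq R) t : x1' g t ^+ 2 <= (A + 1) ^+ 2.
  rewrite -[leLHS]real_normK ?num_real// ler_sqr ?nnegrE//; last lra.
  by have [_ /(_ (inl m1))[_ ->]] := QP t.
have x2b (g : seq R) t : x2' g t ^+ 2 <= (A + 1) ^+ 2.
  rewrite -[leLHS]real_normK ?num_real// ler_sqr ?nnegrE//; last lra.
  by have [_ /(_ (inr m2))[_ ->]] := QP t.
(* One half pays for the tracking error off [U], the other for the energy at most [(A + 1) ^+ 2] on
   [U]. *)
have kapE : kap%:E = (kap / 2 + (A + 1) ^+ 2 * ((3 * n + 2)%:R * b))%:E.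
  by rewrite bA -splitr.
have k20 : 0 <= kap / 2 by rewrite divr_ge0// ltW.
have m_traj' t := measurable_trajectory m1 m2 N s1 s2 rho mE'.1 mE'.2 (3 * n) t.
move=> t tn; have [_ Ddel D1] := DnP t.+1 tn; have /andP[D0 _] := D01 t.+1.
split; rewrite kapE.
  rewrite !energy1E//; apply: (expectation_le_good _ _ _ _ mU PU) => //.
  - by apply: measurable_funX; have [] := m_traj j t.
  - by apply: measurable_funX; have [] := m_traj' t.
  - by move=> g; exact: sqr_ge0.
  - by move=> g; exact: sqr_ge0.
  - exact: ltW.
  - by move=> g Ug; have [? _ ? _ _] := track g Ug t tn; apply: sqle D0 Ddel D1.
rewrite !energy2E//; apply: (expectation_le_good _ _ _ _ mU PU) => //.
- by apply: measurable_funX; have [] := m_traj j t.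
- by apply: measurable_funX; have [] := m_traj' t.
- by move=> g; exact: sqr_ge0.
- by move=> g; exact: sqr_ge0.
- exact: ltW.
- by move=> g Ug; have [_ ? _ ? _] := track g Ug t tn; apply: sqle D0 Ddel D1.
Qed.

End RobustCode.

(** * Shift-invariant codes *)

Lemma card_bigcup_le (I T : finType) (Q : pred I) (F : I -> {set T}) :
  (#|(\bigcup_(i | Q i) F i)%SET| <= \sum_(i | Q i) #|F i|)%N.
Proof.
elim/big_rec2: _ => [|i n A _ IH]; first by rewrite cards0.
by apply: leq_trans (leq_card_setU _ _) _; rewrite leq_add2l.
Qed.

Section ShiftInvariantCodes.
Context (M k : nat).
Local Notation word := {ffun 'I_k -> 'I_M.+1}.
Local Open Scope set_scope.
Local Open Scope nat_scope.

Definition hdist (x y : word) := #|[set j | x j != y j]|.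

Definition cst_word (m : 'I_M.+1) : word := [ffun=> m].

(** Words are added coordinatewise modulo [M.+1]. *)
Definition shift_closed (C : {set word}) :=
  [forall x in C, forall m, (x + cst_word m)%R \in C].

Definition min_dist (r : nat) (C : {set word}) :=
  [forall x in C, forall y in C, (x != y) ==> (r < hdist x y)].

Lemma hdistC x y : hdist x y = hdist y x.
Proof. by apply: eq_card => j; rewrite !inE eq_sym. Qed.

Lemma hdist_triangle y x z : hdist x z <= hdist x y + hdist y z.
Proof.
apply: leq_trans (leq_card_setU _ _); apply: subset_leq_card.
apply/fintype.subsetP => j; rewrite !inE -negb_and; apply: contra => /andP[/eqP-> /eqP->].
exact: eqxx.
Qed.

Lemma hdistD x y z : hdist (x + z)%R (y + z)%R = hdist x y.
Proof.
apply: eq_card => j; rewrite !inE !ffunE.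
by rewrite (inj_eq (@GRing.addIr _ (z j))).
Qed.

(** A word of the ball is determined by a set of at most [r] positions, for which there are at most
    [2 ^ k] choices, and its letters there. *)
Lemma card_hball (c : word) r :
  #|[set x | hdist x c <= r]| <= 2 ^ k * M.+1 ^ r.
Proof.
pose F (S : {set 'I_k}) := [set x : word | [forall j, (j \notin S) ==> (x j == c j)]].
have cF S : #|F S| = M.+1 ^ #|S|.
  have -> : #|F S| = #|family (fun j => if j \in S then predT else pred1 (c j))|.
    apply: eq_card => x; rewrite inE; apply/forallP/familyP => H j; have := H j.
      by case: (j \in S) => //= /eqP ->; rewrite inE eqxx.
    by case: (j \in S).
  rewrite card_family foldrE big_map big_enum /= -prod_nat_const [RHS]big_mkcond/=.
  by apply: eq_bigr => j _; case: (j \in S); rewrite ?cardT ?size_enum_ord ?card1.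
have sub : [set x | hdist x c <= r] \subset \bigcup_(S : {set 'I_k} | #|S| <= r) F S.
  apply/fintype.subsetP => x; rewrite inE => xr; apply/bigcupP.
  exists [set j | x j != c j] => //; rewrite inE; apply/forallP => j.
  by rewrite inE negbK; apply/implyP.
apply: leq_trans (subset_leq_card sub) _.
apply: leq_trans (card_bigcup_le _ _) _.
apply: (@leq_trans (\sum_(S : {set 'I_k}) M.+1 ^ r)).
  rewrite [leqRHS](bigID (fun S : {set 'I_k} => #|S| <= r))/=.
  by apply: leq_trans (leq_addr _ _); apply: leq_sum => S Sr; rewrite cF leq_pexp2l.
rewrite sum_nat_const; suff -> : #|{set 'I_k}| = 2 ^ k by [].
rewrite -[in RHS](card_ord k) -[in RHS]cardsT -card_powerset.
by apply: eq_card => S; rewrite !inE finset.subsetT.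
Qed.

(* A maximal shift-invariant code of minimum distance above [r] has covering radius at
   most [r]: otherwise all the shifts of an uncovered word could be added to it. *)
Lemma gilbert_varshamov r : r < k ->
  exists C : {set word}, [/\ shift_closed C, min_dist r C &
    M.+1 ^ k <= #|C| * (2 ^ k * M.+1 ^ r)].
Proof.
move=> rk.
pose good C := shift_closed C && min_dist r C.
have good0 : good finset.set0 by apply/andP; split; apply/forall_inP => x; rewrite inE.
have [C /andP[sC dC] maxC] := @arg_maxnP _ finset.set0 good (fun C => #|C|) good0.
exists C; split => //.
have cover : [set: word] \subset \bigcup_(c in C) [set x | hdist x c <= r].
  apply/fintype.subsetP => x _; apply/bigcupP.
  have [[c cC xc]|nc] := pselect (exists2 c, c \in C & hdist x c <= r).
    by exists c => //; rewrite inE.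
  exfalso; have far c : c \in C -> r < hdist x c.
    by move=> cC; rewrite ltnNge; apply/negP => xc; apply: nc; exists c.
  pose C' := C :|: [set (x + cst_word m)%R | m : 'I_M.+1].
  have xC : x \notin C.
    by apply/negP => /far; rewrite /hdist (_ : finset _ = finset.set0) ?cards0//;
      apply/setP => j; rewrite !inE eqxx.
  have x0 : x = (x + cst_word 0)%R by apply/ffunP => j; rewrite !ffunE addr0.
  (* Shifting both words back by [m] keeps the second one in the code and turns the first one into
     [x]. *)
  have farm m c : c \in C -> r < hdist (x + cst_word m)%R c.
    move=> cC; rewrite -(hdistD _ _ (cst_word (- m))).
    have -> : (x + cst_word m + cst_word (- m))%R = x.
      by apply/ffunP => j; rewrite !ffunE addrK.
    by apply: far; move/forall_inP: sC => /(_ _ cC)/forallP.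
  have : good C'.
    apply/andP; split.
      apply/forall_inP => y; rewrite inE => /orP[yC|/imsetP[m _ ->]]; apply/forallP => m'.
        by rewrite inE; move/forall_inP: sC => /(_ _ yC)/forallP ->.
      rewrite inE; apply/orP; right; apply/imsetP; exists (m + m')%R => //.
      by apply/ffunP => j; rewrite !ffunE addrA.
    apply/forall_inP => y; rewrite inE => /orP[yC|/imsetP[m _ ->]];
    apply/forall_inP => z; rewrite inE => /orP[zC|/imsetP[m' _ ->]]; apply/implyP => yz.
    - by move/forall_inP: dC => /(_ _ yC)/forall_inP/(_ _ zC)/implyP; apply.
    - by rewrite hdistC; apply: farm.
    - exact: farm.
    (* Two distinct shifts of [x] differ in all the [k] positions; this is where [r < k] enters. *)
    - rewrite /hdist (_ : finset _ = finset.setT) ?cardsT ?card_ord//.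
      apply/setP => j; rewrite !inE !ffunE; apply: contra yz => /eqP/addrI ->.
      exact: eqxx.
  move=> /maxC; apply/negP; rewrite -ltnNge; apply: proper_card.
  apply/properP; split; first exact: finset.subsetUl.
  by exists x => //; rewrite inE; apply/orP; right; apply/imsetP; exists 0%R.
have := subset_leq_card cover; rewrite cardsT card_ffun !card_ord => /leq_trans; apply.
apply: leq_trans (card_bigcup_le _ _) _.
by rewrite -sum_nat_const; apply: leq_sum => c _; exact: card_hball.
Qed.

(** Each coordinate of a uniform codeword is uniform: averaging over the shifts makes the letter run
    through the whole alphabet. Multiples replace divisions, so [V] can be any commutative
    monoid. *)
Lemma shift_closed_sum (V : nmodType) (C : {set word}) (F : 'I_M.+1 -> V) (j : 'I_k) :
  shift_closed C ->
  (\sum_(c in C) F (c j) *+ M.+1 = (\sum_m F m) *+ #|C|)%R.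
Proof.
move=> sC.
have sh m : (\sum_(c in C) F (c j) = \sum_(c in C) F (c j + m))%R.
  rewrite (reindex_inj (@GRing.addIr _ (cst_word m)))/=.
  apply: eq_big => c; last by move=> _; rewrite !ffunE.
  apply/idP/idP => [cC|cC].
    have -> : c = (c + cst_word m + cst_word (- m))%R.
      by apply/ffunP => i; rewrite !ffunE addrK.
    by move/forall_inP: sC => /(_ _ cC)/forallP.
  by move/forall_inP: sC => /(_ _ cC)/forallP.
rewrite sumrMnl.
have -> : ((\sum_(c in C) F (c j)) *+ M.+1 =
    \sum_(m < M.+1) \sum_(c in C) F (c j + m))%R.
  under [RHS]eq_bigr do rewrite -sh.
  by rewrite sumr_const card_ord.
rewrite exchange_big/= -sumr_const; apply: eq_bigr => c _.
by rewrite [RHS](reindex_inj (@GRing.addrI _ (c j))).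
Qed.

End ShiftInvariantCodes.

(** * Concatenated codes *)

Lemma gauss_seq_slice {R : realType} K a m (f : seq R -> \bar R) : (a + m <= K)%N ->
  (forall s, (0 <= f s)%E) -> seq_measurable m f ->
  gauss_seq K (fun s => f (take m (drop a s))) = gauss_seq m f.
Proof.
move=> amK f0 mf.
have -> : K = (a + (m + (K - (a + m))))%N by rewrite addnA subnKC.
rewrite (@gauss_seq_drop _ a _ (fun s => f (take m s)))//; first exact: gauss_seq_take.
have := @seq_measurable_slice R _ _ (m + (K - (a + m))) m 0 f.
rewrite add0n leq_addr => /(_ isT mf).
by apply: eq_measurable_fun => t _; rewrite drop0.
Qed.

Lemma drop_mkseq (T : Type) (f : nat -> T) a b :
  drop a (mkseq f (a + b)) = mkseq (fun i => f (a + i)%N) b.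
Proof.
by rewrite /mkseq -map_drop drop_iota add0n addKn -{1}(addn0 a) iotaDl -map_comp.
Qed.

Lemma take_mkseq (T : Type) (f : nat -> T) a b : (a <= b)%N ->
  take a (mkseq f b) = mkseq f a.
Proof. by move=> ab; rewrite /mkseq -map_take take_iota (minn_idPl ab). Qed.

Lemma sum_blocks (V : nmodType) (F : nat -> V) (k n : nat) :
  \sum_(t < k * n) F t = \sum_(j < k) \sum_(i < n) F (j * n + i)%N.
Proof.
elim: k => [|k IH]; first by rewrite mul0n !big_ord0.
rewrite big_ord_recr/= -IH mulSnr big_split_ord/=.
by congr (_ + _).
Qed.

Section Concatenation.
Context {R : realType} (M1 M2 n k r : nat)
  (e1 : nat -> 'I_M1.+1 -> seq R -> R) (e2 : nat -> 'I_M2.+1 -> seq R -> R)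
  (de : seq R -> 'I_M1.+1 * 'I_M2.+1)
  (C1 : {set {ffun 'I_k -> 'I_M1.+1}}) (C2 : {set {ffun 'I_k -> 'I_M2.+1}})
  (d1 : {ffun 'I_k -> 'I_M1.+1}) (d2 : {ffun 'I_k -> 'I_M2.+1})
  (a01 : 'I_#|C1|) (a02 : 'I_#|C2|).
Hypothesis n0 : (0 < n)%N.
Local Notation C := (@Code R M1.+1 M2.+1 e1 e2 de).

(** Reads a coordinate at a natural number, as block indices are computed from times; beyond the
    word it returns [ord0]. *)
Definition letter M (w : {ffun 'I_k -> 'I_M.+1}) (j : nat) : 'I_M.+1 :=
  oapp w ord0 (insub j).

(** Time [t] is position [t %% n] of block [t %/ n]. Only the feedback of the current block is
    passed on, so each block restarts the inner code; from time [k * n] on the transmitter is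
    silent. *)
Definition outer_enc M (e : nat -> 'I_M.+1 -> seq R -> R)
    (CC : {set {ffun 'I_k -> 'I_M.+1}}) d (t : nat) (a : 'I_#|CC|) (v : seq R) : R :=
  if (t < k * n)%N then e (t %% n)%N (letter (enum_val a + d) (t %/ n)) (drop (t %/ n * n) v)
  else 0.

(** Bounded-distance decoding: with minimum distance above [2 * r], at most one codeword
    qualifies. *)
Definition min_decode M (CC : {set {ffun 'I_k -> 'I_M.+1}}) (a0 : 'I_#|CC|) w : 'I_#|CC| :=
  odflt a0 [pick a : 'I_#|CC| | (hdist w (enum_val a) <= r)%N].

Definition block_dec (y : seq R) (j : 'I_k) := de (take n (drop (j * n) y)).

Definition outer_dec (y : seq R) :=
  (min_decode a01 ([ffun j => (block_dec y j).1] - d1),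
   min_decode a02 ([ffun j => (block_dec y j).2] - d2)).

Definition outer_code : code R :=
  @Code R #|C1| #|C2| (outer_enc e1 d1) (outer_enc e2 d2) outer_dec.

Definition slice (g : seq R) (j : nat) := take (3 * n) (drop (j * (3 * n)) g).

Lemma letterE M (w : {ffun 'I_k -> 'I_M.+1}) (j : 'I_k) : letter w j = w j.
Proof. by rewrite /letter valK. Qed.

Lemma nth_slice g j i c : (i < n)%N -> (c < 3)%N ->
  nth 0 (slice g j) (3 * i + c) = nth 0 g (3 * (j * n + i) + c).
Proof.
move=> i_n c3; rewrite /slice nth_take; last by lia.
by rewrite nth_drop; congr nth; lia.
Qed.

Section Run.
Variables (a1 : 'I_#|C1|) (a2 : 'I_#|C2|) (N s1 s2 rho : R) (g : seq R).
Let m1 j := letter (enum_val a1 + d1) j.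
Let m2 j := letter (enum_val a2 + d2) j.

Lemma slice_noise j i : (i < n)%N ->
  [/\ nth 0 (slice g j) (3 * i) = nth 0 g (3 * (j * n + i)),
      fbnoise1 s1 (slice g j) i = fbnoise1 s1 g (j * n + i) &
      fbnoise2 s2 rho (slice g j) i = fbnoise2 s2 rho g (j * n + i)].
Proof.
move=> i_n.
have h0 := @nth_slice g j i 0 i_n isT; rewrite !addn0 in h0.
have h1 := @nth_slice g j i 1 i_n isT; rewrite !addn1 in h1.
have h2 := @nth_slice g j i 2 i_n isT; rewrite !addn2 in h2.
by rewrite /fbnoise1 /fbnoise2 h0 h1 h2.
Qed.

(** Within block [j] the run is an inner run driven by the noise of that block, by induction on the
    position inside the block. *)
Lemma outer_trajectory j i : (j < k)%N -> (i < n)%N ->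
  [/\ sent1 (C := outer_code) a1 a2 N s1 s2 rho g (j * n + i) =
        sent1 (C := C) (m1 j) (m2 j) N s1 s2 rho (slice g j) i,
      sent2 (C := outer_code) a1 a2 N s1 s2 rho g (j * n + i) =
        sent2 (C := C) (m1 j) (m2 j) N s1 s2 rho (slice g j) i &
      received (C := outer_code) a1 a2 N s1 s2 rho g (j * n + i) =
        received (C := C) (m1 j) (m2 j) N s1 s2 rho (slice g j) i].
Proof.
move=> jk; elim/ltn_ind: i => i IH i_n.
have tk : (j * n + i < k * n)%N.
  by rewrite (leq_trans (_ : _ < j.+1 * n)%N)// ?leq_mul2r ?jk ?orbT// mulSnr ltn_add2l.
have td : ((j * n + i) %/ n = j)%N by rewrite divnMDl// divn_small// addn0.
have tm : ((j * n + i) %% n = i)%N by rewrite modnMDl modn_small.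
have h1 : sent1 (C := outer_code) a1 a2 N s1 s2 rho g (j * n + i) =
    sent1 (C := C) (m1 j) (m2 j) N s1 s2 rho (slice g j) i.
  rewrite /sent1 /= /outer_enc tk td tm; congr e1.
  rewrite !feedback1E drop_mkseq; apply/eq_in_map => i'.
  rewrite mem_iota add0n => /= i'i.
  have [_ _ ->] := IH i' i'i (ltn_trans i'i i_n).
  by have [_ -> _] := slice_noise j (ltn_trans i'i i_n).
have h2 : sent2 (C := outer_code) a1 a2 N s1 s2 rho g (j * n + i) =
    sent2 (C := C) (m1 j) (m2 j) N s1 s2 rho (slice g j) i.
  rewrite /sent2 /= /outer_enc tk td tm; congr e2.
  rewrite !feedback2E drop_mkseq; apply/eq_in_map => i'.
  rewrite mem_iota add0n => /= i'i.
  have [_ _ ->] := IH i' i'i (ltn_trans i'i i_n).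
  by have [_ _ ->] := slice_noise j (ltn_trans i'i i_n).
by split => //; rewrite /received h1 h2; have [-> _ _] := slice_noise j i_n.
Qed.

Lemma outer_silent t : (k * n <= t)%N ->
  sent1 (C := outer_code) a1 a2 N s1 s2 rho g t = 0 /\
  sent2 (C := outer_code) a1 a2 N s1 s2 rho g t = 0.
Proof. by move=> kt; rewrite /sent1 /sent2 /= /outer_enc ltnNge kt. Qed.

Definition inner_error (j : nat) : bool :=
  de (outputs (C := C) (m1 j) (m2 j) N s1 s2 rho (slice g j) n) != (m1 j, m2 j).

Lemma outer_block_dec L (j : 'I_k) : (k * n <= L)%N ->
  block_dec (outputs (C := outer_code) a1 a2 N s1 s2 rho g L) j =
  de (outputs (C := C) (m1 j) (m2 j) N s1 s2 rho (slice g j) n).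
Proof.
move=> kL; rewrite /block_dec !outputs_mkseq; congr de.
have jL : (j * n + n <= L)%N.
  by apply: leq_trans kL; rewrite -mulSnr leq_mul2r ltn_ord orbT.
rewrite -(subnKC (leq_trans (leq_addr _ _) jL)) drop_mkseq take_mkseq; last by lia.
apply/eq_in_map => i; rewrite mem_iota add0n => /= i_n.
by have [_ _ ->] := outer_trajectory (ltn_ord j) i_n.
Qed.

Lemma min_decode_correct M (CC : {set {ffun 'I_k -> 'I_M.+1}}) (a0 a : 'I_#|CC|) w :
  min_dist (2 * r) CC -> (hdist w (enum_val a) <= r)%N -> min_decode a0 w = a.
Proof.
move=> dCC wa; rewrite /min_decode; case: pickP => [a' wa'|/(_ a)]; last by rewrite wa.
apply: enum_val_inj; apply/eqP; apply: contraLR isT => neq.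
move/forall_inP: dCC => /(_ _ (enum_valP a'))/forall_inP/(_ _ (enum_valP a))/implyP.
move=> /(_ neq); rewrite ltnNge mul2n -addnn => /negP; case.
by apply: leq_trans (hdist_triangle w _ _) _; rewrite leq_add// hdistC.
Qed.

(** A block whose pair is decoded correctly is correct for both users. With at most [r] wrong blocks
    both received words, once the dithers are removed, are within distance [r] of the sent
    codewords. *)
Lemma outer_error_count L : (k * n <= L)%N ->
  min_dist (2 * r) C1 -> min_dist (2 * r) C2 ->
  outer_dec (outputs (C := outer_code) a1 a2 N s1 s2 rho g L) != (a1, a2) ->
  (r < \sum_(j < k) inner_error j)%N.
Proof.
move=> kL dC1 dC2; apply: contraR; rewrite -leqNgt => few.
have close M (CC : {set {ffun 'I_k -> 'I_M.+1}}) (a : 'I_#|CC|) d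
    (w : {ffun 'I_k -> 'I_M.+1}) :
    (forall j : 'I_k, ~~ inner_error j -> w j = (enum_val a + d) j) ->
    (hdist (w - d)%R (enum_val a) <= r)%N.
  move=> H; apply: leq_trans few; rewrite /hdist -sum1_card big_mkcond/=.
  apply: leq_sum => j _; rewrite inE.
  case: (boolP (inner_error j)) => [_|/H wj]; first by case: ifP.
  by rewrite !ffunE wj !ffunE addrK eqxx.
apply/eqP; congr pair; apply: min_decode_correct => //; apply: close => j;
by rewrite ffunE outer_block_dec// negbK => /eqP dj; rewrite dj /=; exact: letterE.
Qed.

End Run.

Section Measurability.
Hypothesis mE : measurable_encoders C.
Hypothesis mD : measurable_decoder C n.

Lemma measurable_outer_enc M (e : nat -> 'I_M.+1 -> seq R -> R)
    (CC : {set {ffun 'I_k -> 'I_M.+1}}) d :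
  (forall t m, seq_measurable t (e t m)) ->
  forall t a, seq_measurable t (@outer_enc M e CC d t a).
Proof.
move=> me t a; rewrite /seq_measurable /outer_enc.
case: (boolP (t < k * n)%N) => _; last exact: measurable_cst.
apply: (@measurable_seq_comp _ _ _ _ _ (t %% n)%N _
  (fun v : t.-tuple R => drop (t %/ n * n) v)) => //.
- by move=> v; rewrite size_drop size_tuple {1}(divn_eq t n) addKn.
- move=> i _; under eq_fun do rewrite nth_drop.
  exact: measurable_nth.
Qed.

Lemma measurable_outer_encoders : measurable_encoders outer_code.
Proof. by split; apply: measurable_outer_enc; [exact: mE.1|exact: mE.2]. Qed.

(** The decoder factors through the finitely many possible vectors [V] of block decisions, each of
    which is a measurable event. *)
Lemma measurable_outer_decoder L : (k * n <= L)%N -> measurable_decoder outer_code L.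
Proof.
move=> kL m.
pose V (v : seq R) : {ffun 'I_k -> 'I_M1.+1 * 'I_M2.+1} := [ffun j => block_dec v j].
pose h (b : {ffun 'I_k -> 'I_M1.+1 * 'I_M2.+1}) :=
  (min_decode a01 ([ffun j => (b j).1] - d1), min_decode a02 ([ffun j => (b j).2] - d2)).
have hV v : outer_dec v = h (V v).
  have E1 : [ffun j => (block_dec v j).1] = [ffun j => (V v j).1].
    by apply/ffunP => j; rewrite !ffunE.
  have E2 : [ffun j => (block_dec v j).2] = [ffun j => (V v j).2].
    by apply/ffunP => j; rewrite !ffunE.
  by rewrite /outer_dec /h E1 E2.
have mB (j : 'I_k) x : measurable [set v : L.-tuple R | block_dec v j = x].
  have mb : seq_measurable n (fun v => de v == x).
    apply: (measurable_fun_bool true); rewrite setTI.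
    have := mD x; rewrite /= => /(eq_ind _ measurable); apply.
    by apply/seteqP; split=> v /= /eqP.
  have jL : (j * n + n <= L)%N.
    by apply: leq_trans kL; rewrite -mulSnr leq_mul2r ltn_ord orbT.
  have := seq_measurable_slice jL mb.
  move=> /(_ measurableT [set true] I); rewrite setTI.
  by move=> /(eq_ind _ measurable); apply; apply/seteqP; split=> v /= /eqP.
have mV b : measurable [set v : L.-tuple R | V v = b].
  rewrite (_ : mkset _ =
      \bigcap_(j in [set: 'I_k]) [set v : L.-tuple R | block_dec v j = b j]).
    exact: fin_bigcap_measurable.
  apply/seteqP; split=> v /=.
    by move=> <- j _; rewrite /= ffunE.
  by move=> H; apply/ffunP => j; rewrite ffunE; apply: H.
rewrite (_ : mkset _ = \bigcup_(b in [set b | h b = m]) [set v : L.-tuple R | V v = b]).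
  exact: fin_bigcup_measurable.
apply/seteqP; split=> v /=; first by rewrite hV => hm; exists (V v).
by move=> [b /= hb vb]; rewrite hV vb.
Qed.

Section Statistics.
Variables (L : nat) (N s1 s2 rho : R).
Hypothesis kL : (k * n <= L)%N.

Let m1 (a1 : 'I_#|C1|) (j : 'I_k) := (enum_val a1 + d1) j.
Let m2 (a2 : 'I_#|C2|) (j : 'I_k) := (enum_val a2 + d2) j.

Let slice_le (j : 'I_k) : (j * (3 * n) + 3 * n <= 3 * L)%N.
Proof. by have := ltn_ord j; nia. Qed.

Lemma outer_energy a1 a2 (j : 'I_k) i : (i < n)%N ->
  energy1 (C := outer_code) L N s1 s2 rho a1 a2 (j * n + i) =
    energy1 (C := C) n N s1 s2 rho (m1 a1 j) (m2 a2 j) i /\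
  energy2 (C := outer_code) L N s1 s2 rho a1 a2 (j * n + i) =
    energy2 (C := C) n N s1 s2 rho (m1 a1 j) (m2 a2 j) i.
Proof.
move=> i_n; have [t1 t2 _] :=
  measurable_trajectory (C := C) (m1 a1 j) (m2 a2 j) N s1 s2 rho mE.1 mE.2 (3 * n) i.
split.
  rewrite /energy1 -(@gauss_seq_slice _ _ _ _ _ (slice_le j)); last 2 first.
  - by move=> s; rewrite lee_fin sqr_ge0.
  - by apply/measurable_EFinP; exact: measurable_funX.
  apply: eq_gauss_seq => g _.
  by have [-> _ _] := outer_trajectory a1 a2 N s1 s2 rho g (ltn_ord j) i_n;
    rewrite !letterE.
rewrite /energy2 -(@gauss_seq_slice _ _ _ _ _ (slice_le j)); last 2 first.
- by move=> s; rewrite lee_fin sqr_ge0.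
- by apply/measurable_EFinP; exact: measurable_funX.
apply: eq_gauss_seq => g _.
by have [_ -> _] := outer_trajectory a1 a2 N s1 s2 rho g (ltn_ord j) i_n;
  rewrite !letterE.
Qed.

Lemma outer_energy_silent a1 a2 t : (k * n <= t)%N ->
  energy1 (C := outer_code) L N s1 s2 rho a1 a2 t = 0%E /\
  energy2 (C := outer_code) L N s1 s2 rho a1 a2 t = 0%E.
Proof.
move=> kt; split; rewrite -[RHS](@gauss_seq_cst R (3 * L)); apply: eq_gauss_seq => g _;
by have [x1 x2] := outer_silent a1 a2 N s1 s2 rho g kt; rewrite ?x1 ?x2 expr0n.
Qed.

(* Chernoff bound: [B ^ (number of wrong blocks)] factorizes over the blocks. *)
Lemma outer_error_le (B : R) (er : 'I_M1.+1 -> 'I_M2.+1 -> R) a1 a2 : 1 <= B ->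
  min_dist (2 * r) C1 -> min_dist (2 * r) C2 ->
  (forall m m', error (C := C) n N s1 s2 rho m m' = (er m m')%:E) ->
  (error (C := outer_code) L N s1 s2 rho a1 a2 <=
    ((B ^+ r.+1)^-1 * \prod_(j < k) (1 + (B - 1) * er (m1 a1 j) (m2 a2 j)))%:E)%E.
Proof.
move=> B1 dC1 dC2 erE.
have B0 : 0 < B by lra.
pose lm1 j := letter (enum_val a1 + d1) j.
pose lm2 j := letter (enum_val a2 + d2) j.
(* This is [B] raised to the error indicator of block [j], written in affine form so that its
   expectation is immediate. *)
pose f (j : nat) (s : seq R) : R := 1 + (B - 1) *
  (de (outputs (C := C) (lm1 j) (lm2 j) N s1 s2 rho s n) != (lm1 j, lm2 j))%:R.
have f1 j s : 1 <= f j s by rewrite /f lerDl mulr_ge0//; lra.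
have mer j : seq_measurable (3 * n) (fun s =>
    (de (outputs (C := C) (lm1 j) (lm2 j) N s1 s2 rho s n) != (lm1 j, lm2 j))%:R : R).
  exact: (@measurable_error R C n N s1 s2 rho mE _ _ mD).
have mf j : seq_measurable (3 * n) (f j).
  by apply: measurable_funD => //; apply: measurable_funM => //; exact: mer.
have fE j : gauss_seq (3 * n) (fun s => (f j s)%:E) =
    (1 + (B - 1) * er (lm1 j) (lm2 j))%:E.
  rewrite gauss_seqE; last 2 first.
  - by move=> s; rewrite lee_fin; apply: le_trans (f1 j s).
  - by apply/measurable_EFinP; exact: mf.
  have mErE : measurable_fun [set: (3 * n).-tuple R] (fun s : (3 * n).-tuple R =>
    ((de (outputs (C := C) (lm1 j) (lm2 j) N s1 s2 rho s n) != (lm1 j, lm2 j))%:R : R)%:E).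
    by apply/measurable_EFinP; exact: mer.
  have B10 : (0 <= (B - 1)%:E)%E by rewrite lee_fin; lra.
  under eq_integral do rewrite /f EFinD EFinM.
  rewrite ge0_integralD//; last 2 first.
  - by move=> s _; apply: mule_ge0 => //; rewrite lee_fin.
  - exact: measurable_funeM.
  rewrite integral_cst//= probability_setT mule1 ge0_integralZl//.
  by rewrite -(errorE N s1 s2 rho mE (lm1 j) (lm2 j) mD) erE.
(* The noise of the silent period is left over after the [k] blocks. *)
have LE : (3 * L = k * (3 * n) + (3 * L - k * (3 * n)))%N by rewrite subnKC//; nia.
have Br0 : 0 <= (B ^+ r.+1)^-1 by rewrite invr_ge0 exprn_ge0// ltW.
have mprod : seq_measurable (3 * L)
    (fun g => \prod_(j < k) f j (take (3 * n) (drop (j * (3 * n)) g))).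
  by apply: measurable_prod => j _; apply: seq_measurable_slice (slice_le j) _.
have -> : (((B ^+ r.+1)^-1 * \prod_(j < k) (1 + (B - 1) * er (m1 a1 j) (m2 a2 j)))%:E =
    gauss_seq (3 * L) (fun g => ((B ^+ r.+1)^-1)%:E *
      (\prod_(j < k) f j (take (3 * n) (drop (j * (3 * n)) g)))%:E))%E.
  have h1 : (0 <= ((B ^+ r.+1)^-1)%:E)%E by rewrite lee_fin.
  have h2 s : (0 <= (\prod_(j < k) f j (take (3 * n) (drop (j * (3 * n)) s)))%:E)%E.
    by rewrite lee_fin prodr_ge0// => j _; apply: le_trans (f1 _ _).
  rewrite gauss_seqZl//; last by apply/measurable_EFinP; exact: mprod.
  rewrite EFinM; congr (_ * _)%E.
  rewrite [in RHS]LE (@gauss_seq_blocks _ (3 * n) k _ f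
    (fun j => 1 + (B - 1) * er (lm1 j) (lm2 j)))//; last first.
    by move=> j s; apply: le_trans (f1 _ _).
  by congr EFin; apply: eq_bigr => j _; rewrite /lm1 /lm2 !letterE.
rewrite errorE; [|exact: measurable_outer_encoders|exact: measurable_outer_decoder].
rewrite gauss_seqE; last 2 first.
- move=> s; rewrite -EFinM lee_fin mulr_ge0// prodr_ge0// => j _.
  by apply: le_trans (f1 _ _).
- by apply: measurable_funeM; apply/measurable_EFinP; exact: mprod.
apply: ge0_le_integral => //.
- apply/measurable_EFinP; apply: (@measurable_error R outer_code L N s1 s2 rho).
    exact: measurable_outer_encoders.
  exact: measurable_outer_decoder.
- by apply: measurable_funeM; apply/measurable_EFinP; exact: mprod.
move=> g _; rewrite -EFinM lee_fin.
have P1 : \prod_(j < k) f j (take (3 * n) (drop (j * (3 * n)) g)) =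
    B ^+ (\sum_(j < k) inner_error a1 a2 N s1 s2 rho g j).
  rewrite -prodrXr; apply: eq_bigr => j _; rewrite /f -/(slice g j).
  rewrite /inner_error -/(lm1 j) -/(lm2 j).
  by case: (_ != _); rewrite ?expr1 ?expr0 ?mulr1 ?mulr0 ?addr0// addrC subrK.
rewrite P1; case: (boolP (_ != _)) => [err|_]; last first.
  by rewrite mulr_ge0// exprn_ge0// ltW.
(* Markov's inequality pointwise: an error forces at least [r.+1] wrong blocks, so the product is at
   least [B ^+ r.+1]. *)
have cnt := outer_error_count kL dC1 dC2 err.
by rewrite ler_pdivlMl ?exprn_gt0// mulr1 ler_weXn2l.
Qed.

End Statistics.

End Measurability.

End Concatenation.

(** * Averages over messages, codewords and dithers *)

Section AverageFormulas.
Context {R : realType} (C : code R) (n : nat) (N s1 s2 rho : R).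

Lemma err_probE : err_prob C n N s1 s2 rho =
  (((nM1 C * nM2 C)%:R)^-1%:E *
    \sum_(m1 < nM1 C) \sum_(m2 < nM2 C) error (C := C) n N s1 s2 rho m1 m2)%E.
Proof.
rewrite /err_prob /avgE; congr (_ * _)%E.
by apply: eq_bigr => m1 _; apply: eq_bigr => m2 _; rewrite /error -gaussE_seq.
Qed.

Lemma power1E : power1 C n N s1 s2 rho =
  ((n%:R)^-1%:E * \sum_(t < n) (((nM1 C * nM2 C)%:R)^-1%:E *
    \sum_(m1 < nM1 C) \sum_(m2 < nM2 C) energy1 (C := C) n N s1 s2 rho m1 m2 t))%E.
Proof.
rewrite /power1 /avgE; congr (_ * _)%E; apply: eq_bigr => t _; congr (_ * _)%E.
apply: eq_bigr => m1 _; apply: eq_bigr => m2 _; rewrite /energy1 -gaussE_seq.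
by congr gaussE; apply/funext => g; rewrite inputs1_mkseq nth_mkseq.
Qed.

Lemma power2E : power2 C n N s1 s2 rho =
  ((n%:R)^-1%:E * \sum_(t < n) (((nM1 C * nM2 C)%:R)^-1%:E *
    \sum_(m1 < nM1 C) \sum_(m2 < nM2 C) energy2 (C := C) n N s1 s2 rho m1 m2 t))%E.
Proof.
rewrite /power2 /avgE; congr (_ * _)%E; apply: eq_bigr => t _; congr (_ * _)%E.
apply: eq_bigr => m1 _; apply: eq_bigr => m2 _; rewrite /energy2 -gaussE_seq.
by congr gaussE; apply/funext => g; rewrite inputs2_mkseq nth_mkseq.
Qed.

End AverageFormulas.

Lemma exists_le_average {R : realType} (D : finType) (G : D -> R) (c : R) (d0 : D) :
  \sum_d G d <= #|D|%:R * c -> exists d, G d <= c.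
Proof.
move=> Gc; apply: contrapT => /forallNP H.
suff : #|D|%:R * c < \sum_d G d by rewrite ltNge Gc.
rewrite mulr_natl -sumr_const.
apply: ltr_sum; first by apply/hasP; exists d0; rewrite ?mem_index_enum.
by move=> d _; rewrite ltNge; apply/negP; apply: H.
Qed.

Lemma sum_words_prod {R : realType} (M1 M2 k : nat) (F : 'I_M1.+1 -> 'I_M2.+1 -> R) :
  \sum_(x1 : {ffun 'I_k -> 'I_M1.+1}) \sum_(x2 : {ffun 'I_k -> 'I_M2.+1})
    \prod_(j < k) F (x1 j) (x2 j) = (\sum_m1 \sum_m2 F m1 m2) ^+ k.
Proof.
under eq_bigr => x1 _ do rewrite -(bigA_distr_bigA (fun j m => F (x1 j) m))/=.
rewrite -(bigA_distr_bigA (fun (j : 'I_k) m => \sum_m2 F m m2))/=.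
by rewrite prodr_const card_ord.
Qed.

Section PowerOfConcatenation.
Context {R : realType} (M1 M2 n k L : nat)
  (C1 : {set {ffun 'I_k -> 'I_M1.+1}}) (C2 : {set {ffun 'I_k -> 'I_M2.+1}})
  (d1 : {ffun 'I_k -> 'I_M1.+1}) (d2 : {ffun 'I_k -> 'I_M2.+1}).
Hypotheses (sC1 : shift_closed C1) (sC2 : shift_closed C2).

(** The pair of inner messages sent in block [j] is exactly uniform, whatever the dithers. *)
Lemma shift_closed_sum2 (G : 'I_M1.+1 -> 'I_M2.+1 -> R) (j : 'I_k) :
  (M1.+1 * M2.+1)%:R * \sum_(a1 < #|C1|) \sum_(a2 < #|C2|)
    G ((enum_val a1 + d1) j) ((enum_val a2 + d2) j) =
  (#|C1| * #|C2|)%:R * \sum_m1 \sum_m2 G m1 m2.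
Proof.
have E2 m : (\sum_(a2 < #|C2|) G m ((enum_val a2 + d2) j)) *+ M2.+1 =
    (\sum_m2 G m m2) *+ #|C2|.
  under eq_bigr do rewrite ffunE.
  rewrite -(big_enum_val (fun c : {ffun 'I_k -> 'I_M2.+1} => G m (c j + d2 j)))/= -sumrMnl.
  rewrite (shift_closed_sum (fun x => G m (x + d2 j)) j sC2); congr (_ *+ _).
  by rewrite [RHS](reindex_inj (@addIr _ (d2 j))).
have E1 (H : 'I_M1.+1 -> R) : (\sum_(a1 < #|C1|) H ((enum_val a1 + d1) j)) *+ M1.+1 =
    (\sum_m1 H m1) *+ #|C1|.
  under eq_bigr do rewrite ffunE.
  rewrite -(big_enum_val (fun c : {ffun 'I_k -> 'I_M1.+1} => H (c j + d1 j)))/= -sumrMnl.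
  rewrite (shift_closed_sum (fun x => H (x + d1 j)) j sC1); congr (_ *+ _).
  by rewrite [RHS](reindex_inj (@addIr _ (d1 j))).
rewrite !mulr_natl mulrnA.
rewrite (E1 (fun m => \sum_(a2 < #|C2|) G m ((enum_val a2 + d2) j))).
rewrite -mulrnA mulnC mulrnA -sumrMnl.
under eq_bigr do rewrite E2.
by rewrite sumrMnl -mulrnA mulnC.
Qed.

(** Each block may spend [n.+1] times [P] although it lasts only [n] channel uses: the length [L]
    contains one silent use for each block. *)
Lemma power_le (P : R) (E : 'I_#|C1| -> 'I_#|C2| -> nat -> \bar R)
    (ep : nat -> 'I_M1.+1 -> 'I_M2.+1 -> R) :
  0 <= P -> (k * n <= L)%N -> (k * n.+1 <= L)%N -> (0 < L)%N ->
  (0 < #|C1|)%N -> (0 < #|C2|)%N ->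
  (forall a1 a2 (j : 'I_k) i, (i < n)%N ->
    E a1 a2 (j * n + i)%N = (ep i ((enum_val a1 + d1) j) ((enum_val a2 + d2) j))%:E) ->
  (forall a1 a2 t, (k * n <= t)%N -> E a1 a2 t = 0%E) ->
  \sum_(i < n) \sum_m1 \sum_m2 ep i m1 m2 <= (M1.+1 * M2.+1)%:R * (n.+1%:R * P) ->
  (L%:R^-1%:E * (\sum_(t < L) ((#|C1| * #|C2|)%:R^-1%:E *
    \sum_(a1 < #|C1|) \sum_(a2 < #|C2|) E a1 a2 t)) <= P%:E)%E.
Proof.
move=> P0 knL kL L0 c1 c2 Ee E0 epP.
have cc : (#|C1| * #|C2|)%:R != 0 :> R by rewrite pnatr_eq0 muln_eq0 negb_or -!lt0n c1.
have mm : (M1.+1 * M2.+1)%:R != 0 :> R by rewrite pnatr_eq0 muln_eq0.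
pose S t := ((#|C1| * #|C2|)%:R^-1%:E * \sum_(a1 < #|C1|) \sum_(a2 < #|C2|) E a1 a2 t)%E.
have Sblock (j : 'I_k) i : (i < n)%N -> S (j * n + i)%N =
    ((M1.+1 * M2.+1)%:R^-1 * \sum_m1 \sum_m2 ep i m1 m2)%:E.
  move=> i_n; rewrite /S.
  under eq_bigr => a1 _ do under eq_bigr => a2 _ do rewrite (Ee a1 a2 j i i_n).
  under eq_bigr do rewrite sumEFin.
  rewrite sumEFin -EFinM; congr EFin.
  apply: (mulfI mm); rewrite mulrA [_ * _^-1]mulrC -mulrA shift_closed_sum2.
  by rewrite mulKf// mulVKf.
have -> : (\sum_(t < L) S t =
    (k%:R * ((M1.+1 * M2.+1)%:R^-1 * \sum_(i < n) \sum_m1 \sum_m2 ep i m1 m2))%:E)%E.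
  have LE : L = (k * n + (L - k * n))%N by rewrite subnKC.
  rewrite [in LHS]LE big_split_ord/= [X in (_ + X)%E]big1 ?adde0; last first.
    move=> t _; rewrite /S big1 ?mule0// => a1 _; rewrite big1// => a2 _.
    by rewrite E0// leq_addr.
  rewrite (sum_blocks S).
  have Sj (j : 'I_k) : (\sum_(i < n) S (j * n + i)%N =
      ((M1.+1 * M2.+1)%:R^-1 * \sum_(i < n) \sum_m1 \sum_m2 ep i m1 m2)%:E)%E.
    by rewrite mulr_sumr -sumEFin; apply: eq_bigr => i _; exact: Sblock.
  rewrite (eq_bigr _ (fun j _ => Sj j)).
  by rewrite sumEFin sumr_const card_ord mulr_natl.
rewrite -EFinM lee_fin ler_pdivrMl ?ltr0n//.
apply: (@le_trans _ _ (k%:R * (n.+1%:R * P))).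
  by rewrite ler_wpM2l// ler_pdivrMl// lt0r mm/=.
by rewrite mulrA -natrM ler_wpM2r// ler_nat.
Qed.

End PowerOfConcatenation.

Section Concatenate.
Context {R : realType} (M1 M2 n q : nat)
  (e1 : nat -> 'I_M1.+1 -> seq R -> R) (e2 : nat -> 'I_M2.+1 -> seq R -> R)
  (de : seq R -> 'I_M1.+1 * 'I_M2.+1) (P1 P2 N s1 s2 rho : R).
Local Notation C := (@Code R M1.+1 M2.+1 e1 e2 de).
Hypotheses (mE : measurable_encoders C) (mD : measurable_decoder C n).
Hypotheses (n0 : (0 < n)%N) (q3 : (2 < q)%N) (P10 : 0 <= P1) (P20 : 0 <= P2).
Variables (ep1 ep2 : nat -> 'I_M1.+1 -> 'I_M2.+1 -> R) (er : 'I_M1.+1 -> 'I_M2.+1 -> R).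
Hypothesis ep1E : forall i m1 m2, (i < n)%N ->
  energy1 (C := C) n N s1 s2 rho m1 m2 i = (ep1 i m1 m2)%:E.
Hypothesis ep2E : forall i m1 m2, (i < n)%N ->
  energy2 (C := C) n N s1 s2 rho m1 m2 i = (ep2 i m1 m2)%:E.
Hypothesis erE : forall m1 m2, error (C := C) n N s1 s2 rho m1 m2 = (er m1 m2)%:E.
Hypothesis ep1P :
  \sum_(i < n) \sum_m1 \sum_m2 ep1 i m1 m2 <= (M1.+1 * M2.+1)%:R * (n.+1%:R * P1).
Hypothesis ep2P :
  \sum_(i < n) \sum_m1 \sum_m2 ep2 i m1 m2 <= (M1.+1 * M2.+1)%:R * (n.+1%:R * P2).
Hypothesis erP : \sum_m1 \sum_m2 er m1 m2 <= (M1.+1 * M2.+1)%:R * (4 ^+ q)^-1.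

Lemma concatenated_code (L : nat) : (n < L)%N ->
  let k := (L %/ n.+1)%N in
  exists O : code R, [/\ valid_code O L P1 P2 N s1 s2 rho,
    (err_prob O L N s1 s2 rho <= ((2 ^+ k)^-1)%:E)%E,
    (M1.+1 ^ k <= nM1 O * (2 ^ k * M1.+1 ^ (2 * (k %/ q))))%N &
    (M2.+1 ^ k <= nM2 O * (2 ^ k * M2.+1 ^ (2 * (k %/ q))))%N].
Proof.
move=> nL k; pose r := (k %/ q)%N.
have L0 : (0 < L)%N by exact: leq_ltn_trans (leq0n n) nL.
have k0 : (0 < k)%N by rewrite divn_gt0.
have kL : (k * n.+1 <= L)%N by exact: leq_trunc_div.
have knL : (k * n <= L)%N by apply: leq_trans kL; rewrite leq_mul2l leqnSn orbT.
have rk : (2 * r < k)%N by have := leq_trunc_div k q; rewrite -/r; nia.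
have qr : (k < q * r.+1)%N by rewrite mulnC; apply: ltn_ceil; lia.
have [C1 [sC1 dC1 cC1]] := @gilbert_varshamov M1 k (2 * r) rk.
have [C2 [sC2 dC2 cC2]] := @gilbert_varshamov M2 k (2 * r) rk.
have c1 : (0 < #|C1|)%N.
  by case: #|C1| cC1 => //; rewrite mul0n leqn0 expn_eq0.
have c2 : (0 < #|C2|)%N.
  by case: #|C2| cC2 => //; rewrite mul0n leqn0 expn_eq0.
pose a01 : 'I_#|C1| := Ordinal c1; pose a02 : 'I_#|C2| := Ordinal c2.
(* The average inner error is at most the inverse of [B], so each block contributes a factor at most
   2 on average. As [k < q * r.+1], the denominator [B ^+ r.+1] is at least [4 ^ k], which leaves
   [2 ^ - k]. *)
pose B : R := 4 ^+ q.
have B1 : 1 <= B by rewrite exprn_ege1// ler1n.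
have B0 : 0 < B by apply: lt_le_trans B1.
pose phi m m' : R := 1 + (B - 1) * er m m'.
pose W := ({ffun 'I_k -> 'I_M1.+1} * {ffun 'I_k -> 'I_M2.+1})%type.
pose bd (d : W) (a1 : 'I_#|C1|) (a2 : 'I_#|C2|) : R := (B ^+ r.+1)^-1 *
  \prod_(j < k) phi ((enum_val a1 + d.1) j) ((enum_val a2 + d.2) j).
have phiS : 0 <= \sum_m1 \sum_m2 phi m1 m2 <= (M1.+1 * M2.+1)%:R * 2.
  have -> : \sum_m1 \sum_m2 phi m1 m2 =
      (M1.+1 * M2.+1)%:R + (B - 1) * \sum_m1 \sum_m2 er m1 m2.
    rewrite mulr_sumr -[(M1.+1 * M2.+1)%:R]/(1 *+ _) mulnC mulrnA.
    rewrite -[1 *+ M2.+1 *+ M1.+1](_ : \sum_(m1 < M1.+1) 1 *+ M2.+1 = _); last first.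
      by rewrite sumr_const card_ord.
    rewrite -big_split/=; apply: eq_bigr => m1 _.
    by rewrite mulr_sumr big_split/= sumr_const card_ord.
  have er0 : 0 <= \sum_m1 \sum_m2 er m1 m2.
    apply: sumr_ge0 => m1 _; apply: sumr_ge0 => m2 _; rewrite -lee_fin -erE.
    by apply: gauss_seq_ge0 => s; rewrite lee_fin.
  apply/andP; split; first by rewrite addr_ge0// mulr_ge0// subr_ge0.
  rewrite mulr2n mulrDr mulr1 lerD2l.
  apply: (@le_trans _ _ (B * ((M1.+1 * M2.+1)%:R * B^-1))); last first.
    by rewrite mulrCA divff ?mulr1// gt_eqF.
  by apply: ler_pM => //; rewrite ?subr_ge0//; lra.
have [d dP] : exists d : W, \sum_(a1 < #|C1|) \sum_(a2 < #|C2|) bd d a1 a2 <=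
    (#|C1| * #|C2|)%:R * (2 ^+ k)^-1.
  apply: (@exists_le_average _ W _ _ (0, 0)).
  rewrite exchange_big/=; under eq_bigr do rewrite exchange_big/=.
  apply: (@le_trans _ _ (\sum_(a1 < #|C1|) \sum_(a2 < #|C2|) #|{: W}|%:R * (2 ^+ k)^-1)).
    apply: ler_sum => a1 _; apply: ler_sum => a2 _; rewrite /bd -mulr_sumr.
    rewrite -(pair_bigA _ (fun x1 x2 =>
      \prod_(j < k) phi ((enum_val a1 + x1) j) ((enum_val a2 + x2) j)))/=.
    (* A uniform dither absorbs the codeword, so the pairs of letters become independent and
       uniform. *)
    have sh M (F : {ffun 'I_k -> 'I_M.+1} -> R) (z : {ffun 'I_k -> 'I_M.+1}) :
        \sum_(x : {ffun 'I_k -> 'I_M.+1}) F (z + x) = \sum_x F x.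
      by rewrite [RHS](reindex_inj (@addrI _ z)).
    rewrite (sh _ (fun x1 : {ffun 'I_k -> 'I_M1.+1} =>
      \sum_x2 \prod_(j < k) phi (x1 j) ((enum_val a2 + x2) j))).
    under eq_bigr => x1 _ do rewrite (sh _ (fun x2 : {ffun 'I_k -> 'I_M2.+1} =>
      \prod_(j < k) phi (x1 j) (x2 j))).
    rewrite sum_words_prod card_prod !card_ffun !card_ord -expnMn.
    have [s0 s2'] := andP phiS.
    apply: (@le_trans _ _ ((B ^+ r.+1)^-1 * ((M1.+1 * M2.+1)%:R * 2) ^+ k)).
      by rewrite ler_wpM2l ?invr_ge0 ?exprn_ge0 ?(ltW B0)// lerXn2r ?nnegrE// mulr_ge0.
    rewrite exprMn natrX mulrCA ler_wpM2l ?exprn_ge0//.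
    rewrite ler_pdivrMl ?exprn_gt0// ler_pdivlMr ?exprn_gt0//.
    rewrite -exprMn -natrM /B -exprM; apply: ler_weXn2l; first by rewrite ler1n.
    exact: ltnW.
  rewrite sumr_const sumr_const card_ord card_ord -mulrnA mulnC -[leLHS]mulr_natl.
  by rewrite mulrCA.
pose O := @outer_code R M1 M2 n k r e1 e2 de C1 C2 d.1 d.2 a01 a02.
have oe a1 a2 (j : 'I_k) i : (i < n)%N ->
    energy1 (C := O) L N s1 s2 rho a1 a2 (j * n + i) =
      energy1 (C := C) n N s1 s2 rho ((enum_val a1 + d.1) j) ((enum_val a2 + d.2) j) i /\
    energy2 (C := O) L N s1 s2 rho a1 a2 (j * n + i) =
      energy2 (C := C) n N s1 s2 rho ((enum_val a1 + d.1) j) ((enum_val a2 + d.2) j) i.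
  exact: outer_energy.
have os a1 a2 t : (k * n <= t)%N -> energy1 (C := O) L N s1 s2 rho a1 a2 t = 0%E /\
    energy2 (C := O) L N s1 s2 rho a1 a2 t = 0%E by exact: outer_energy_silent.
exists O; split => //.
- split => //.
  + exact: measurable_outer_encoders.
  + exact: measurable_outer_decoder.
  + split; [rewrite power1E|rewrite power2E].
      apply: (@power_le R M1 M2 n k L C1 C2 d.1 d.2 sC1 sC2 P1 _ ep1) => //.
      * by move=> a1 a2 j i i_n; rewrite (oe _ _ _ _ i_n).1 ep1E.
      * by move=> a1 a2 t kt; exact: (os _ _ _ kt).1.
    apply: (@power_le R M1 M2 n k L C1 C2 d.1 d.2 sC1 sC2 P2 _ ep2) => //.
    * by move=> a1 a2 j i i_n; rewrite (oe _ _ _ _ i_n).2 ep2E.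
    * by move=> a1 a2 t kt; exact: (os _ _ _ kt).2.
- rewrite err_probE.
  have cc : 0 < (#|C1| * #|C2|)%:R :> R by rewrite ltr0n muln_gt0 c1.
  apply: (@le_trans _ _ ((#|C1| * #|C2|)%:R^-1 *
    \sum_(a1 < #|C1|) \sum_(a2 < #|C2|) bd d a1 a2)%:E); last first.
    by rewrite lee_fin ler_pdivrMl.
  rewrite EFinM; apply: lee_wpmul2l; first by rewrite lee_fin invr_ge0 ltW.
  rewrite -sumEFin; apply: lee_sum => a1 _; rewrite -sumEFin; apply: lee_sum => a2 _.
  exact: outer_error_le.
Qed.

End Concatenate.

(** * Rates and the capacity regions *)

Section AverageBounds.
Context {R : realType}.

(** Since all the terms are nonnegative, a finite average makes every single term finite, as
    truncation requires, and the bound can be restated in real numbers. *)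
Lemma average_bound (M1 M2 n : nat) (P : R) (E : 'I_M1 -> 'I_M2 -> nat -> \bar R) :
  (0 < n)%N -> (0 < M1)%N -> (0 < M2)%N -> (forall m1 m2 t, 0 <= E m1 m2 t)%E ->
  (n%:R^-1%:E * \sum_(t < n) ((M1 * M2)%:R^-1%:E *
    \sum_(m1 < M1) \sum_(m2 < M2) E m1 m2 t) <= P%:E)%E ->
  (forall m1 m2 t, (t < n)%N -> (E m1 m2 t < +oo)%E) /\
  \sum_(t < n) \sum_(m1 < M1) \sum_(m2 < M2) fine (E m1 m2 t) <=
    (M1 * M2)%:R * (n%:R * P).
Proof.
move=> n0 M10 M20 E0.
have m0 : 0 < (M1 * M2)%:R :> R by rewrite ltr0n muln_gt0 M10.
have S0 t : (0 <= \sum_(m1 < M1) \sum_(m2 < M2) E m1 m2 t)%E.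
  by apply: sume_ge0 => m1 _; apply: sume_ge0.
rewrite -ge0_sume_distrr// lee_pdivrMl ?ltr0n// lee_pdivrMl// -!EFinM => EP.
have fin m1 m2 t : (t < n)%N -> (E m1 m2 t < +oo)%E.
  move=> tn; apply: (@le_lt_trans _ _ (((M1 * M2)%:R * (n%:R * P))%:E)); last exact: ltry.
  apply: le_trans EP; rewrite (bigD1 (Ordinal tn))//= (bigD1 m1)//= (bigD1 m2)//=.
  rewrite -!addeA leeDl// adde_ge0 ?sume_ge0// adde_ge0 ?sume_ge0//.
  by move=> ? _; apply: sume_ge0.
split => //; rewrite -lee_fin; apply: le_trans EP.
rewrite -sumEFin; apply: lee_sum => t _; rewrite -sumEFin; apply: lee_sum => m1 _.
rewrite -sumEFin; apply: lee_sum => m2 _.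
by rewrite fineK// ge0_fin_numE// fin.
Qed.

(** Four losses are paid: a fraction [2 / q] for the minimum distance, [ln 2] per block for the
    factor [2 ^ k], one silent use per block, and an incomplete last block. The first three are
    covered by [eps], the last by [del]. *)
Lemma concatenated_rate (M K n q L : nat) (rate eps del : R) :
  let k := (L %/ n.+1)%N in
  0 < eps -> 0 < del -> (0 < M)%N -> (0 < K)%N -> (0 < n)%N -> (2 < q)%N -> (n < L)%N ->
  (M ^ k <= K * (2 ^ k * M ^ (2 * (k %/ q))))%N ->
  16 * `|rate| <= eps * q%:R -> 4 * (`|rate| + 1) <= eps * n%:R ->
  `|rate| * n.+1%:R < del * L%:R ->
  rate - eps / 8 < ln M%:R / n%:R ->
  rate - eps / 2 - del < ln K%:R / L%:R.
Proof.
move=> k eps0 del0 M0 K0 n0 q3 nL cK hq hn hL hr.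
have L0 : 0 < L%:R :> R by rewrite ltr0n (leq_ltn_trans _ nL).
have nR : 0 < n%:R :> R by rewrite ltr0n.
have lnK0 : 0 <= ln K%:R :> R by rewrite ln_ge0// ler1n.
(* A nonpositive target is met by any nonempty message set. *)
have [rle|rgt] := leP (rate - eps / 2) 0.
  apply: lt_le_trans (divr_ge0 lnK0 (ltW L0)); lra.
have rate0 : 0 < rate by lra.
rewrite (gtr0_norm rate0) in hq hn hL.
have lnM0 : 0 <= ln M%:R :> R by rewrite ln_ge0// ler1n.
have kL : L%:R < (k%:R + 1) * n.+1%:R :> R by rewrite natr1 -natrM ltr_nat ltn_ceil.
have rq : (k %/ q)%:R * q%:R <= k%:R :> R by rewrite -natrM ler_nat leq_trunc_div.
have qR : 0 < q%:R :> R by rewrite ltr0n (ltn_trans _ q3).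
have lnle : k%:R * ln M%:R <= ln K%:R + (k%:R * ln 2 + (2 * (k %/ q))%:R * ln M%:R) :> R.
  have MR : 0 < M%:R :> R by rewrite ltr0n.
  have : ln (M ^ k)%:R <= ln (K * (2 ^ k * M ^ (2 * (k %/ q))))%:R :> R.
    by rewrite ler_ln ?posrE ?ltr0n ?ler_nat// ?muln_gt0 ?expn_gt0 ?K0 ?M0.
  rewrite !natrM !natrX !lnM ?posrE ?mulr_gt0 ?exprn_gt0 ?ltr0n//.
  by rewrite !lnXn ?ltr0n// !mulr_natl -mulrnA mulr_natl [(_ * 2)%N]mulnC.
have ln2 : ln 2 <= 1 :> R by have := @le_ln1Dx R 1; rewrite -[1 + 1]/(2%:R); apply; lra.
set x := ln M%:R in hr lnM0 lnle *.
have xn : n%:R * (rate - eps / 8) < x by rewrite mulrC -ltr_pdivlMr.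
have kx : (2 * (k %/ q))%:R * x <= k%:R * (2 / q%:R * x).
  rewrite mulrA ler_wpM2r// natrM mulrCA ler_wpM2l//.
  by rewrite ler_pdivlMr.
have q2 : 2 / q%:R <= 1 :> R.
  by rewrite ler_pdivrMr// mul1r ler_nat ltnW.
have q2' : 2 / q%:R * rate <= eps / 8.
  by rewrite mulrAC ler_pdivrMr//; lra.
(* The claim for a single block with its silent use: [hq] controls the fraction [2 / q], and [hn]
   the silent use and [ln 2]. *)
have main : n.+1%:R * (rate - eps / 2) <= (1 - 2 / q%:R) * x - ln 2.
  have h1 : (1 - 2 / q%:R) * (n%:R * (rate - eps / 8)) <= (1 - 2 / q%:R) * x.
    by rewrite ler_wpM2l ?subr_ge0// ltW.
  have q20 : 0 <= 2 / q%:R :> R by rewrite divr_ge0.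
  have h2 : rate - eps / 4 <= (1 - 2 / q%:R) * (rate - eps / 8).
    by rewrite mulrBl mul1r mulrBr; nra.
  have h3 : n%:R * (rate - eps / 4) <= n%:R * ((1 - 2 / q%:R) * (rate - eps / 8)).
    by rewrite ler_wpM2l.
  rewrite mulrCA in h3; rewrite -natr1; lra.
have lnK : k%:R * (n.+1%:R * (rate - eps / 2)) <= ln K%:R.
  have := @ler_wpM2l _ k%:R (ler0n _ _) _ _ main; rewrite mulrBr mulrBl mulrBr mul1r.
  lra.
rewrite ltr_pdivlMr//; apply: lt_le_trans lnK.
have h1 : (rate - eps / 2) * L%:R < (rate - eps / 2) * ((k%:R + 1) * n.+1%:R).
  by rewrite ltr_pM2l.
have h2 : (rate - eps / 2) * n.+1%:R <= rate * n.+1%:R by rewrite ler_wpM2r//; lra.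
have h3 : (rate - eps / 2) * ((k%:R + 1) * n.+1%:R) =
  k%:R * (n.+1%:R * (rate - eps / 2)) + (rate - eps / 2) * n.+1%:R by ring.
rewrite h3 in h1; rewrite mulrBl; lra.
Qed.

End AverageBounds.

(** The slack [delta] in the definition is split in two: half for moving to a nearby achievable
    pair, half for the codes of that pair. *)
Lemma NoisyFB_closed (R : realType) (P1 P2 N s1 s2 rho : R) :
  closed (NoisyFB P1 P2 N s1 s2 rho).
Proof.
move=> r cr delta delta0.
have d2 : 0 < delta / 2 by rewrite divr_gt0.
have [r' [r'P /= [b1 b2]]] := cr _ (nbhsx_ballx r _ d2).
have [n0 [Cs [HCs Herr]]] := r'P _ d2.
exists n0, Cs; split => // n nn0; have [v l1 l2] := HCs n nn0.
move: b1 b2; rewrite /ball/= !ltr_norml => /andP[_ b1] /andP[_ b2].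
by split => //; [apply: le_lt_trans l1|apply: le_lt_trans l2]; lra.
Qed.

(** One robust inner code and one threshold serve all small covariances. Only the outer code,
    through its dithers, is chosen after the covariance. *)
Lemma NoisyFB_near_perfect (R : realType) (P1 P2 N : R) (r : R * R) (eps : R) :
  0 < P1 -> 0 < P2 -> 0 < eps -> PerfectFB P1 P2 N r ->
  exists sig2 : R, 0 < sig2 /\
    forall s1 s2 rho : R, 0 <= s1 -> 0 <= s2 -> -1 <= rho <= 1 ->
      s1 ^+ 2 <= sig2 -> s2 ^+ 2 <= sig2 ->
      NoisyFB P1 P2 N s1 s2 rho (r.1 - eps / 2, r.2 - eps / 2).
Proof.
move=> P10 P20 eps0 rP.
have e8 : 0 < eps / 8 by rewrite divr_gt0.
have [n0 [Cs [HCs Herr]]] := rP _ e8.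
pose ra := `|r.1| + `|r.2|.
have ra1 : `|r.1| <= ra by rewrite lerDl.
have ra2 : `|r.2| <= ra by rewrite lerDr.
have ra0 : 0 <= ra by rewrite addr_ge0.
pose q := (Num.truncn (16 * ra / eps) + 3)%N.
have q3 : (2 < q)%N by rewrite /q addn3.
have hq : 16 * ra <= eps * q%:R.
  rewrite -ler_pdivrMl// [_^-1 * _]mulrC; apply: le_trans (ltW (truncnS_gt _)) _.
  by rewrite ler_nat /q addn3 ltnS; exact: leq_trans (leqnSn _) (leqnSn _).
(* Half of the inner error budget; the other half is reserved for the passage to the robust code. *)
have eta0 : 0 < (4 ^+ q)^-1 / 2 :> R by rewrite divr_gt0// invr_gt0 exprn_gt0.
have [n1 Hn1] := Herr _ eta0.
(* Large enough for the rates, for the error probability and for the loss of one channel use per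
   block. *)
pose n := (n0 + n1 + (Num.truncn (4 * (ra + 1) / eps)).+1)%N.
have n_gt0 : (0 < n)%N by rewrite /n addnS.
have hn : 4 * (ra + 1) <= eps * n%:R.
  rewrite -ler_pdivrMl// [_^-1 * _]mulrC; apply: le_trans (ltW (truncnS_gt _)) _.
  by rewrite ler_nat /n leq_addl.
have nn0 : (n0 <= n)%N by rewrite /n -addnA leq_addr.
have nn1 : (n1 <= n)%N by rewrite /n addnAC leq_addl.
have [[[M10 M20] [me1 me2] mD [pw1 pw2]] rate1 rate2] := HCs n nn0.
have er := Hn1 n nn1.
move: (Cs n) M10 M20 me1 me2 mD pw1 pw2 rate1 rate2 er => [M1 M2 e1 e2 de] /=.
(* The message sets are nonempty; the successor form gives them the cyclic group structure used by
   the outer codes. *)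
case: M1 e1 de => // M1 e1 de _; case: M2 e2 de => // M2 e2 de _.
set C := Code e1 e2 de => me1 me2 mD pw1 pw2 rate1 rate2 er.
have mE : measurable_encoders C by split.
have g0 (f : seq R -> R) : (forall s, 0 <= f s) -> (0 <= gauss_seq (3 * n) (fun s => (f s)%:E))%E.
  by move=> f0; apply: gauss_seq_ge0 => s; rewrite lee_fin.
have [||fin1 tot1] := @average_bound R M1.+1 M2.+1 n P1
  (energy1 (C := C) n N 0 0 0) n_gt0 isT isT.
- by move=> *; apply: g0 => s; exact: sqr_ge0.
- by move: pw1; rewrite power1E.
have [||fin2 tot2] := @average_bound R M1.+1 M2.+1 n P2
  (energy2 (C := C) n N 0 0 0) n_gt0 isT isT.
- by move=> *; apply: g0 => s; exact: sqr_ge0.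
- by move: pw2; rewrite power2E.
(* The error probability is treated as a single time instant of the same averaging lemma. *)
have [||finer toter] := @average_bound R M1.+1 M2.+1 1 ((4 ^+ q)^-1 / 2)
  (fun m1 m2 _ => error (C := C) n N 0 0 0 m1 m2) isT isT isT.
- by move=> *; apply: g0.
- by move: er; rewrite err_probE big_ord1 invr1 mul1e.
(* The energy of a block grows by at most [n * kap], which must not exceed the power of the silent
   use. *)
pose kap := Num.min ((4 ^+ q)^-1 / 2) (Num.min (P1 / n%:R) (P2 / n%:R)).
have nR : 0 < n%:R :> R by rewrite ltr0n.
have kap0 : 0 < kap by rewrite !lt_min eta0 !divr_gt0.
have kap1 : kap <= (4 ^+ q)^-1 / 2 by rewrite ge_min lexx.
have kap2 : n%:R * kap <= P1 by rewrite mulrC -ler_pdivlMr// !ge_min lexx !orbT.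
have kap3 : n%:R * kap <= P2 by rewrite mulrC -ler_pdivlMr// !ge_min lexx !orbT.
have [e1' [e2' [de' [mE' mD' [sig [sig0 Hsig]]]]]] := robust_code mE mD fin1 fin2 kap0.
exists (sig ^+ 2); split; first by rewrite exprn_gt0.
move=> s1 s2 rho s10 s20 rhoP s1P s2P.
have s1' : 0 <= s1 <= sig by rewrite s10 -ler_sqr ?nnegrE// ltW.
have s2' : 0 <= s2 <= sig by rewrite s20 -ler_sqr ?nnegrE// ltW.
have {}Hsig := Hsig s1 s2 rho s1' s2' rhoP.
move: Hsig mE' mD'; rewrite /=; set C' := Code e1' e2' de' => Hsig mE' mD'.
have fine_le (a b : \bar R) (c : R) : (0 <= a)%E -> (0 <= b)%E -> (b < +oo)%E ->
    (a <= b + c%:E)%E -> a = (fine a)%:E /\ fine a <= fine b + c.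
  move=> a0 b0 bfin ab.
  have bF : b \is a fin_num by rewrite ge0_fin_numE.
  have aF : a \is a fin_num.
    by rewrite ge0_fin_numE// (le_lt_trans ab)// -(fineK bF) -EFinD ltry.
  by rewrite fineK//; split => //; rewrite -lee_fin EFinD !fineK.
have sumle (F G : 'I_M1.+1 -> 'I_M2.+1 -> R) (c : R) :
    (forall m1 m2, F m1 m2 <= G m1 m2 + c) ->
    \sum_m1 \sum_m2 F m1 m2 <= \sum_m1 \sum_m2 G m1 m2 + (M1.+1 * M2.+1)%:R * c.
  move=> FG; have -> : (M1.+1 * M2.+1)%:R * c = \sum_(m1 < M1.+1) \sum_(m2 < M2.+1) c.
    by rewrite !sumr_const !card_ord -mulrnA mulr_natl mulnC.
  rewrite -big_split/=; apply: ler_sum => m1 _; rewrite -big_split/=.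
  by apply: ler_sum => m2 _; exact: FG.
have conc := @concatenated_code R M1 M2 n q e1' e2' de' P1 P2 N s1 s2 rho mE' mD' n_gt0 q3
  (ltW P10) (ltW P20)
  (fun i m1 m2 => fine (energy1 (C := C') n N s1 s2 rho m1 m2 i))
  (fun i m1 m2 => fine (energy2 (C := C') n N s1 s2 rho m1 m2 i))
  (fun m1 m2 => fine (error (C := C') n N s1 s2 rho m1 m2)).
pose good L (O : code R) := let k := (L %/ n.+1)%N in
  [/\ valid_code O L P1 P2 N s1 s2 rho,
    (err_prob O L N s1 s2 rho <= ((2 ^+ k)^-1)%:E)%E,
    (M1.+1 ^ k <= nM1 O * (2 ^ k * M1.+1 ^ (2 * (k %/ q))))%N &
    (M2.+1 ^ k <= nM2 O * (2 ^ k * M2.+1 ^ (2 * (k %/ q))))%N].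
have {}conc L : (n < L)%N -> exists O, good L O.
  move=> nL; apply: conc nL.
  - move=> i m1 m2 i_n.
    have [] := fine_le _ _ _ _ _ (fin1 m1 m2 i i_n) (((Hsig m1 m2).2 i i_n).1) => //.
    + by apply: g0 => s; exact: sqr_ge0.
    + by apply: g0 => s; exact: sqr_ge0.
  - move=> i m1 m2 i_n.
    have [] := fine_le _ _ _ _ _ (fin2 m1 m2 i i_n) (((Hsig m1 m2).2 i i_n).2) => //.
    + by apply: g0 => s; exact: sqr_ge0.
    + by apply: g0 => s; exact: sqr_ge0.
  - move=> m1 m2; have [] := fine_le _ _ _ _ _ (finer m1 m2 0 isT) ((Hsig m1 m2).1) => //.
    + exact: g0.
    + exact: g0.
  - apply: (@le_trans _ _ (\sum_(i < n) (\sum_m1 \sum_m2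
        fine (energy1 (C := C) n N 0 0 0 m1 m2 i) + (M1.+1 * M2.+1)%:R * kap))).
      apply: ler_sum => i _; apply: sumle => m1 m2.
      have [] := fine_le _ _ _ _ _ (fin1 m1 m2 i (ltn_ord i))
        (((Hsig m1 m2).2 i (ltn_ord i)).1) => //.
      + by apply: g0 => s; exact: sqr_ge0.
      + by apply: g0 => s; exact: sqr_ge0.
    rewrite big_split/= sumr_const card_ord -[_ *+ n]mulr_natl mulrCA.
    apply: le_trans (lerD tot1 (lexx _)) _; rewrite -mulrDr ler_wpM2l// -natr1 mulrDl mul1r.
    by rewrite lerD2l.
  - apply: (@le_trans _ _ (\sum_(i < n) (\sum_m1 \sum_m2
        fine (energy2 (C := C) n N 0 0 0 m1 m2 i) + (M1.+1 * M2.+1)%:R * kap))).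
      apply: ler_sum => i _; apply: sumle => m1 m2.
      have [] := fine_le _ _ _ _ _ (fin2 m1 m2 i (ltn_ord i))
        (((Hsig m1 m2).2 i (ltn_ord i)).2) => //.
      + by apply: g0 => s; exact: sqr_ge0.
      + by apply: g0 => s; exact: sqr_ge0.
    rewrite big_split/= sumr_const card_ord -[_ *+ n]mulr_natl mulrCA.
    apply: le_trans (lerD tot2 (lexx _)) _; rewrite -mulrDr ler_wpM2l// -natr1 mulrDl mul1r.
    by rewrite lerD2l.
  - apply: (@le_trans _ _ (\sum_m1 \sum_m2 fine (error (C := C) n N 0 0 0 m1 m2) +
        (M1.+1 * M2.+1)%:R * kap)).
      apply: sumle => m1 m2.
      have [] := fine_le _ _ _ _ _ (finer m1 m2 0 isT) ((Hsig m1 m2).1) => //.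
      + exact: g0.
      + exact: g0.
    move: toter; rewrite big_ord1 mul1r => toter.
    apply: le_trans (lerD toter (lexx _)) _; rewrite -mulrDr ler_wpM2l//; lra.
move=> del del0.
pose L0 := (n + (Num.truncn (ra * n.+1%:R / del)).+1)%N.
(* For lengths too short to contain a block, the inner code serves as a placeholder. *)
have /choice[Os OsP] : forall L, exists O, (n < L)%N -> good L O.
  move=> L; have [nL|Ln] := ltnP n L; last by exists C.
  by have [Oc ?] := conc L nL; exists Oc.
exists L0, Os; split=> [L L0L|eta eta0'].
  have nL : (n < L)%N by apply: leq_trans L0L; rewrite /L0 addnS ltnS leq_addr.
  have hL : ra * n.+1%:R < del * L%:R.
    rewrite -ltr_pdivrMl// [_^-1 * _]mulrC; apply: lt_le_trans (truncnS_gt _) _.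
    by rewrite ler_nat (leq_trans _ L0L)// leq_addl.
  have [v _ k1 k2] := OsP L nL; have [[K1 K2] _ _ _] := v.
  split => //=.
  - apply: (@concatenated_rate R M1.+1 _ n q L) => //.
    + by apply: le_trans hq; rewrite ler_wpM2l.
    + by apply: le_trans hn; rewrite ler_wpM2l// lerD2r.
    + by apply: le_lt_trans hL; rewrite ler_wpM2r.
  - apply: (@concatenated_rate R M2.+1 _ n q L) => //.
    + by apply: le_trans hq; rewrite ler_wpM2l.
    + by apply: le_trans hn; rewrite ler_wpM2l// lerD2r.
    + by apply: le_lt_trans hL; rewrite ler_wpM2r.
(* With at least [k0] blocks, [2 ^ k >= k0 >= eta^-1]. *)
pose k0 := (Num.truncn eta^-1).+1.
exists (n.+1 * k0.+1)%N => L kL.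
have nL : (n < L)%N by apply: leq_trans kL; rewrite leq_pmulr.
have [_ errL _ _] := OsP L nL; apply: le_trans errL _; rewrite lee_fin.
rewrite -[eta]invrK lef_pV2 ?posrE ?exprn_gt0 ?invr_gt0//.
apply: le_trans (ltW (truncnS_gt _)) _; rewrite -natrX ler_nat.
apply: leq_trans (ltnW (ltn_expl _ (isT : 1 < 2)%N)) _; rewrite leq_exp2l//.
by rewrite leq_divRL// mulnC (leq_trans _ kL)// leq_mul2l leqnSn orbT.
Qed.

Unset Implicit Arguments.

Theorem mainTheorem5 (R : realType) (P1 P2 N : R) :
  0 < P1 -> 0 < P2 -> 0 < N ->
  closure [set r : R * R | exists sig2 : R, 0 < sig2 /\
      forall s1 s2 rho : R, 0 <= s1 -> 0 <= s2 -> -1 <= rho <= 1 ->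
        s1 ^+ 2 <= sig2 -> s2 ^+ 2 <= sig2 ->
        NoisyFB P1 P2 N s1 s2 rho r]
  = PerfectFB P1 P2 N.
Proof.
move=> P10 P20 _; apply/seteqP; split=> [r cr|r rP B].
  (* The zero covariance is admissible for every threshold [sig2]. *)
  apply: (@NoisyFB_closed R P1 P2 N 0 0 0); apply: closure_subset cr.
  move=> s [sig2 [sig0 H]]; apply: H => //; rewrite ?expr0n ?(ltW sig0)//.
  by rewrite lerN10 ler01.
move=> /nbhs_ballP[e /= e0 eB].
(* Both coordinates move by [e / 2], which stays inside the ball of radius [e]. *)
exists (r.1 - e / 2, r.2 - e / 2); split.
  exact: NoisyFB_near_perfect.
apply: eB; split; rewrite /ball/= opprB addrCA subrr addr0 gtr0_norm ?divr_gt0//; lra.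
Qed.
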